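(* Let $T_k$ be a $k$-simplex in $\mathbb{R}^k$, and let $F(T_k)$ and $AA(T_k)$ be associated facet and double Alfeld splits of $T_k$. Then for all integers $r,d\ge 0$, $$\dim S^r_d(F(T_k))=\binom{d+k}{k}+A(k,d,r)+(k+1)\,P(k,d,r),$$ $$\dim S^r_d(AA(T_k))=\binom{d+k}{k}+(k+2)\,A(k,d,r),$$ where $$A(k,d,r)=\begin{cases}k\binom{d+k-\frac{(r+1)(k+1)}{2}}{k}, & r\text{ odd},\\[4pt] \binom{d+k-1-\frac{r(k+1)}{2}}{k}+\cdots+\binom{d-\frac{r(k+1)}{2}}{k}, & r\text{ even},\end{cases}$$ $$P(k,d,r)=\begin{cases}(k-1)\binom{d+k-\frac{(r+1)k}{2}}{k}, & r\text{ odd},\\[4pt] \binom{d+k-1-\frac{rk}{2}}{k}+\cdots+\binom{d+1-\frac{rk}{2}}{k}, & r\text{ even}.\end{cases}$$ Moreover, the associated modules of splines $S^r(\widehat{F}(T_k))$ and $S^r(\widehat{AA}(T_k))$ are free over $\mathbb{R}[x_0,\dots,x_k]$ for any $r$.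
   Context: For a $k$-dimensional simplicial complex $\Delta\subseteq\mathbb{R}^k$, $S^r_d(\Delta)$ is the real vector space of $C^r$ functions on $\Delta$ whose restriction to each $k$-simplex of $\Delta$ is a polynomial of degree at most $d$. $\widehat\Delta\subseteq\mathbb{R}^{k+1}$ is the cone over $\Delta$ (place $\Delta$ in the hyperplane $x_0=1$ and cone from the origin), and $S^r(\widehat\Delta)$ is the graded $\mathbb{R}[x_0,\dots,x_k]$-module of $C^r$ functions on $\widehat\Delta$ that are polynomial on each maximal cell; $\dim S^r_d(\Delta)=\dim S^r(\widehat\Delta)_d$. Binomial convention: $\binom{n}{k}=0$ whenever $n<k$ (including negative $n$). In the even cases the upper entries of the binomials decrease by $1$ from term to term, so there are $k$ terms in $A(k,d,r)$ and $k-1$ terms in $P(k,d,r)$. Alfeld split $A(T)$ of a simplex $T$: add one (relatively) interior vertex $u$ and cone from $u$ over the boundary of $T$; its maximal simplices are $[u,F]$ for $F$ a facet of $T$. Facet split $F(T_k)$ (with $k\ge 2$): let $T_k=[v_0,\dots,v_k]$ be a full-dimensional simplex and $A(T_k)$ its Alfeld split with interior vertex $u$. For each $i=0,\dots,k$ let $F_i$ be the facet of $T_k$ opposite $v_i$, and let $u_i$ be the point strictly interior to $F_i$ and collinear with $v_i$ and $u$. Each $u_i$ induces a $(k-1)$-dimensional Alfeld split $A(F_i)$ of $F_i$. Coning from $u$ over $A(F_i)$ gives a pyramid $P_i$; $F(T_k)$ is the collection of the $k+1$ pyramids $P_i$ (it has $k^2+k$ maximal simplices). Double Alfeld split $AA(T_k)$: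 let $T_k=[v_0,\dots,v_k]$ be a full-dimensional simplex and $A(T_k)$ its Alfeld split with interior vertex $u$, and for each $i=0,\dots,k$ let $F_i$ be the facet of $T_k$ opposite $v_i$. For each $i=0,\dots,k$ let $u_i$ be a point strictly interior to the simplex $T_k^i=[u,F_i]$ and collinear with $v_i$ and $u$. Each $u_i$ induces an Alfeld split $A(T_k^i)$ of $T_k^i$; $AA(T_k)$ is the collection of these $k+1$ Alfeld splits (it has $(k+1)^2$ maximal simplices). *)

(* Defs.v *)
From HB Require Import structures.
From mathcomp Require Import all_boot all_order all_algebra.
From mathcomp Require mpoly.
From mathcomp Require Import all_classical all_reals all_analysis.
Set Implicit Arguments.
Unset Strict Implicit.
Unset Printing Implicit Defensive.
Import Order.TTheory GRing.Theory Num.Theory.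
Import numFieldNormedType.Exports.
Import (canonicals, coercions) mpoly.
Local Open Scope classical_set_scope.
Local Open Scope ring_scope.

Section Simplices.
Variables (R : realType) (n : nat).

(* A simplex in R^n is given by its m vertices (so it has dimension m - 1). *)
Definition simplex (m : nat) := 'I_m -> 'rV[R]_n.

Definition affine_independent m (T : simplex m.+1) : Prop :=
  row_free (\matrix_(j < m) (T (lift ord0 j) - T ord0)).

Definition hull m (T : simplex m) : set 'rV[R]_n :=
  [set x | exists a : 'I_m -> R,
    [/\ forall i, 0 <= a i, \sum_i a i = 1 & x = \sum_i a i *: T i]].

(* The relative interior of the hull when the vertices are affinely
   independent. *)
Definition relint m (T : simplex m) : set 'rV[R]_n :=
  [set x | exists a : 'I_m -> R,
    [/\ forall i, 0 < a i, \sum_i a i = 1 & x = \sum_i a i *: T i]].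

Definition facet m (T : simplex m.+1) (i : 'I_m.+1) : simplex m :=
  fun j => T (lift i j).

Definition cone_simplex (a : 'rV[R]_n) m (T : simplex m) : simplex m.+1 :=
  fun j => if unlift ord0 j is Some j' then T j' else a.

(* The line through a and b, for a != b. *)
Definition line (a b : 'rV[R]_n) : set 'rV[R]_n :=
  [set x | exists t : R, x = (1 - t) *: a + t *: b].

(* The i-th maximal simplex is [u, F_i]: since F_i is opposite to vertex i, it
   is obtained by putting u in place of vertex i. *)
Definition alfeld m (T : simplex m) (u : 'rV[R]_n) (i : 'I_m) : simplex m :=
  fun j => if j == i then u else T j.

End Simplices.

(* A pure n-dimensional complex in R^n is represented by the family of its
   maximal simplices. *)
Definition complex (R : realType) (n : nat) (I : finType) :=
  I -> simplex R n n.+1.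

Definition realization (R : realType) (n : nat) (I : finType)
  (D : complex R n I) : set 'rV[R]_n := \bigcup_i hull (D i).

Section Splits.
Variables (R : realType) (k : nat) (T : simplex R k k.+1) (u : 'rV[R]_k).
Variable w : 'I_k.+1 -> 'rV[R]_k.

Definition facet_split_points : Prop :=
  relint T u /\
  forall i, relint (facet T i) (w i) /\ line (T i) u (w i).

Definition facet_split : complex R k ('I_k.+1 * 'I_k)%type :=
  fun ij => cone_simplex u (alfeld (facet T ij.1) (w ij.1) ij.2).

Definition double_alfeld_points : Prop :=
  relint T u /\
  forall i, relint (alfeld T u i) (w i) /\ line (T i) u (w i).

Definition double_alfeld : complex R k ('I_k.+1 * 'I_k.+1)%type :=
  fun ij => alfeld (alfeld T u ij.1) (w ij.1) ij.2.

End Splits.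

Definition hat (R : realType) (k : nat) (I : finType) (D : complex R k I) :
    complex R (1 + k) I :=
  fun i => cone_simplex 0 (fun j => row_mx (const_mx 1 : 'rV[R]_1) (D i j)).

(* f is C^r on the closed set A: its partial derivatives of order at most r
   exist in the interior of A and extend continuously to A.  The values of f
   outside A are irrelevant. *)
Fixpoint Cr (R : realType) (n : nat) (A : set 'rV[R]_n) (r : nat)
    (f : 'rV[R]_n -> R) : Prop :=
  {within A, continuous f} /\
  if r is r'.+1 then
    forall i : 'I_n, exists g : 'rV[R]_n -> R,
      (forall x, A° x -> is_derive x (delta_mx 0 i) f (g x)) /\ Cr A r' g
  else True.

Definition mpoly_eval (R : realType) (n : nat) (x : 'rV[R]_n)
  (p : mpoly.mpoly n R) : R := mpoly.meval (fun i => x 0 i) p.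

(* Real functions on A, as a module over R[x_0, ..., x_{n-1}]: a polynomial
   acts by pointwise multiplication. *)
Definition polyfun (R : realType) (n : nat) (A : set 'rV[R]_n) := A -> R.

Section PolyModule.
Variables (R : realType) (n : nat) (A : set 'rV[R]_n).

HB.instance Definition _ := GRing.Zmodule.on (polyfun A).

Definition polyfun_scale (p : mpoly.mpoly n R) (f : polyfun A) : polyfun A :=
  fun x => mpoly_eval (\val x) p * f x.

Fact polyfun_scaleA p q f :
  polyfun_scale p (polyfun_scale q f) = polyfun_scale (p * q) f.
Proof.
by apply/funext => x; rewrite /polyfun_scale /mpoly_eval rmorphM mulrA.
Qed.

Fact polyfun_scale1 : left_id 1 polyfun_scale.
Proof.
by move=> f; apply/funext => x; rewrite /polyfun_scale /mpoly_eval rmorph1 mul1r.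
Qed.

Fact polyfun_scaleDr : right_distributive polyfun_scale +%R.
Proof. by move=> p f g; apply/funext => x; rewrite /polyfun_scale mulrDr. Qed.

Fact polyfun_scaleDl f : {morph polyfun_scale^~ f : p q / p + q}.
Proof.
by move=> p q; apply/funext => x; rewrite /polyfun_scale /mpoly_eval rmorphD mulrDl.
Qed.

HB.instance Definition _ := GRing.Zmodule_isLmodule.Build (mpoly.mpoly n R)
  (polyfun A) polyfun_scaleA polyfun_scale1 polyfun_scaleDr polyfun_scaleDl.

End PolyModule.

Section Bases.
Variables (K : nzRingType) (V : lmodType K).

(* Every element of S is a unique K-linear combination of the b i, and all
   these combinations lie in S. *)
Definition is_basis (S : set V) (N : nat) (b : 'I_N -> V) : Prop :=
  set_bij [set: {ffun 'I_N -> K}] S (fun c => \sum_i c i *: b i).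

Definition has_dim (S : set V) (N : nat) : Prop :=
  exists b : 'I_N -> V, is_basis S b.

Definition is_free (S : set V) : Prop :=
  exists N, exists b : 'I_N -> V, is_basis S b.

End Bases.

Section Splines.
Variables (R : realType) (n : nat) (I : finType) (D : complex R n I) (r : nat).

(* msize p is the total degree of p plus one, and 0 for p = 0. *)
Definition spline_le (d : nat) : set (realization D -> (R^o : lmodType R)) :=
  [set sigL (realization D) f | f in [set f : 'rV[R]_n -> R |
    Cr (realization D) r f /\
    forall i, exists p : mpoly.mpoly n R, (mpoly.msize p <= d.+1)%N /\
      forall x, hull (D i) x -> f x = mpoly_eval x p]].

Definition spline : set (polyfun (realization D)) :=
  [set sigL (realization D) f | f in [set f : 'rV[R]_n -> R |
    Cr (realization D) r f /\
    forall i, exists p : mpoly.mpoly n R,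
      forall x, hull (D i) x -> f x = mpoly_eval x p]].

Definition spline_free : Prop :=
  @is_free (mpoly.mpoly n R : nzRingType)
    (polyfun (realization D) : lmodType (mpoly.mpoly n R)) spline.

End Splines.
Arguments spline_le {R n I} D r d.
Arguments spline {R n I} D r.
Arguments spline_free {R n I} D r.

(* The binomial coefficient with 'C(m, k) = 0 whenever m < k, for m : int. *)
Definition binz (m : int) (k : nat) : nat := if m is Posz m' then 'C(m', k) else 0.

(* The divisions by 2 below are exact in the branches where they occur. *)
Definition Adim (k d r : nat) : nat :=
  if odd r then
    (k * binz ((d + k)%N%:Z - ((r.+1 * k.+1) %/ 2)%N%:Z) k)%N
  else
    (\sum_(j < k) binz ((d + k)%N%:Z - 1 - j%:Z - ((r * k.+1) %/ 2)%N%:Z) k)%N.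

Definition Pdim (k d r : nat) : nat :=
  if odd r then
    ((k - 1) * binz ((d + k)%N%:Z - ((r.+1 * k) %/ 2)%N%:Z) k)%N
  else
    (\sum_(j < k - 1) binz ((d + k)%N%:Z - 1 - j%:Z - ((r * k) %/ 2)%N%:Z) k)%N.

(* Main.v *)
Require Import Defs.
From HB Require Import structures.
From mathcomp Require Import all_boot all_order all_algebra.
From mathcomp Require mpoly.
From mathcomp Require Import all_classical all_reals all_analysis.
From mathcomp Require Import perm zify ring lra.
From mathcomp.real_closed Require polyrcf.
Set Implicit Arguments.
Unset Strict Implicit.
Unset Printing Implicit Defensive.
Import Order.TTheory GRing.Theory Num.Theory.
Import numFieldNormedType.Exports.
Import (canonicals, coercions) mpoly.
Local Open Scope classical_set_scope.
Local Open Scope ring_scope.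

(** In both splits the walls come in families that are braid arrangements.  For
a simplex with barycentric coordinates b_l and an interior point u, put
z_l = b_l / b_l(u).  The cell of the Alfeld split opposite to vertex a is the
region where z_a is the least of the z_l, so the wall between the cells a and c
lies on the hyperplane z_a = z_c.  Hence a C^r spline on the Alfeld split is a
family (q_a) of polynomials such that (z_a - z_c)^(r+1) divides q_a - q_c
([braid_module]; one direction is [flat_divides], the other [divides_flat]).

This module is free.  Besides the constant family, a basis consists of the
families theta_j(a) = F_j(z_a), where F_j is an antiderivative in t of
prod_l (t - z_l)^e c_j(t), with e = floor(r/2), and c_j(t) = t^j for even r,
c_j(t) = prod_(l <> j) (t - z_l) for odd r.  The difference F_j(z_a) - F_j(z_c)
is an integral between two zeros of the integrand whose orders add up to r at
least, which gives the factor (z_a - z_c)^(r+1) ([divides_antideriv]).  That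
these families generate follows from Saito's criterion: the determinant of
their matrix has the degree of the product of all (z_a - z_c)^(r+1), hence is a
constant multiple of it, and the constant is not zero by Rolle's theorem at a
point where z_0 < ... < z_n ([braid_det_neq0], [braid_det]).  Cramer's rule
then expresses a family in the basis and bounds the degrees of the coefficients
([braid_module_span]).

In the two refined splits, each cell [u, F_i] of the Alfeld split is divided
once more, from a point w_i on the line through v_i and u.  Because of this
collinearity the walls inside [u, F_i] that contain u lie on the same
hyperplanes z_a = z_c as the walls of the Alfeld split.  So a spline on the
refinement of [u, F_i] extends to the whole split: on [u, F_j] take the
polynomial of the piece adjacent to it.  Therefore the splines on the refined
split are the direct sum of the splines on the Alfeld split and, for every i, of
the splines on the refined cell [u, F_i] modulo polynomials
([spline_basis_span], [spline_basis_free]).  The facet split fits into this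
picture with w_i on F_i: then one of the k + 1 subcells of [u, F_i] is flat, and
the k others are governed by a braid arrangement with k instead of k + 1
coordinates, which produces P in place of A.

All conditions are about affine forms, so they pass to the cone by
homogenization ([hat_refinement]), and the same basis yields both the freeness
of the module over the cone ([spline_module_free]) and, through the degree
bounds, the dimensions ([spline_le_dim]). *)

(** * Polynomials in several variables as functions *)

Notation poly_ R n := (mpoly.mpoly n R).
Notation mvar R i := (mpoly.mpolyX R (mpoly.mnm1 i)).

Section PolynomialFunctions.
Variables (R : realType) (n : nat).
Implicit Types (p q : poly_ R n) (x y v : 'rV[R]_n).

(** Structural induction over the ring operations: properties of polynomial functions
are easier to follow through sums and products than through monomials. *)
Lemma mpoly_ring_ind (P : poly_ R n -> Prop) :
    (forall c, P (mpoly.mpolyC n c)) -> (forall i, P (mvar R i)) ->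
    (forall p q, P p -> P q -> P (p + q)) ->
    (forall p q, P p -> P q -> P (p * q)) ->
  forall p, P p.
Proof.
move=> PC PX PD PM p; rewrite (mpoly.mpolyE p).
elim/big_ind: _ => //; first by rewrite -(mpoly.mpolyC0 n R).
move=> m _; rewrite -mpoly.mul_mpolyC; apply: (PM _ _ (PC _)).
rewrite mpoly.mpolyXE_id; elim/big_ind: _ => //.
  by rewrite -(mpoly.mpolyC1 n R).
move=> i _; elim: (m i) => [|k IH]; first by rewrite expr0 -(mpoly.mpolyC1 n R).
by rewrite exprS; apply: PM.
Qed.

Lemma evalC c x : mpoly_eval x (mpoly.mpolyC n c) = c.
Proof. exact: mpoly.mevalC. Qed.
Lemma evalX i x : mpoly_eval x (mvar R i) = x 0 i.
Proof. exact: mpoly.mevalXU. Qed.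
Lemma evalD x : {morph mpoly_eval x : p q / p + q}.
Proof. exact: mpoly.mevalD. Qed.
Lemma evalB x : {morph mpoly_eval x : p q / p - q}.
Proof. exact: mpoly.mevalB. Qed.
Lemma evalM x : {morph mpoly_eval x : p q / p * q}.
Proof. exact: mpoly.mevalM. Qed.
Lemma eval0 x : mpoly_eval x (0 : poly_ R n) = 0.
Proof. exact: mpoly.meval0. Qed.
Lemma eval1 x : mpoly_eval x (1 : poly_ R n) = 1.
Proof. exact: mpoly.meval1. Qed.
Lemma evalZ c p x : mpoly_eval x (c *: p) = c * mpoly_eval x p.
Proof. exact: mpoly.mevalZ. Qed.
Lemma eval_sum (I : finType) (F : I -> poly_ R n) x :
  mpoly_eval x (\sum_i F i) = \sum_i mpoly_eval x (F i).
Proof. exact: raddf_sum. Qed.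
Lemma evalXn p k x : mpoly_eval x (p ^+ k) = mpoly_eval x p ^+ k.
Proof. exact: rmorphXn. Qed.

Lemma mderivU (i j : 'I_n) : mpoly.mderiv i (mvar R j) = (i == j)%:R.
Proof.
rewrite mpoly.mderivX mpoly.mnm1E eq_sym; case: eqP => [->|_]; last by rewrite scale0r.
have -> : mpoly.mnm_sub (mpoly.mnm1 j) (mpoly.mnm1 j) = @mpoly.mnm0 n.
  by apply/mpoly.mnmP => k; rewrite mpoly.mnmBE mpoly.mnm0E subnn.
by rewrite mpoly.mpolyX0 scale1r.
Qed.

(** Restriction to a line reduces statements on polynomials in several variables to
polynomials in one variable, where a function with infinitely many zeros vanishes. *)
Lemma line_polyP p x v : exists P : {poly R},
  (forall t, P.[t] = mpoly_eval (x + t *: v) p) /\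
  (forall t, P^`().[t] =
     \sum_i v 0 i * mpoly_eval (x + t *: v) (mpoly.mderiv i p)).
Proof.
elim/mpoly_ring_ind: p => [c|i|p q [P [P1 P2]] [Q [Q1 Q2]]|p q [P [P1 P2]] [Q [Q1 Q2]]].
- exists c%:P; split=> t; rewrite ?hornerC ?evalC // derivC horner0 big1 // => i _.
  by rewrite mpoly.mderivC eval0 mulr0.
- exists ((x 0 i)%:P + (v 0 i)%:P * 'X); split=> t.
    by rewrite evalX !hornerE !mxE mulrC.
  rewrite derivD derivC add0r derivM derivX derivC mul0r add0r mulr1 hornerC.
  rewrite (bigD1 i) //= mderivU eqxx eval1 mulr1 big1 ?addr0 // => j ji.
  by rewrite mderivU (negbTE ji) eval0 mulr0.
- exists (P + Q); split=> t; first by rewrite hornerD P1 Q1 evalD.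
  rewrite derivD hornerD P2 Q2 -big_split; apply: eq_bigr => i _ /=.
  by rewrite mpoly.mderivD evalD mulrDr.
- exists (P * Q); split=> t; first by rewrite hornerM P1 Q1 evalM.
  rewrite derivM hornerD !hornerM P1 P2 Q1 Q2 mulr_suml mulr_sumr -big_split.
  apply: eq_bigr => i _ /=; rewrite mpoly.mderivM evalD !evalM.
  by rewrite mulrDr mulrA (mulrCA (v 0 i)).
Qed.

Lemma poly_eq0_itv (P : {poly R}) (c : R) :
  0 < c -> (forall t, 0 < t < c -> P.[t] = 0) -> P = 0.
Proof.
move=> c0 H; pose s := [seq c / (i.+2)%:R | i <- iota 0 (size P)].
apply: (@roots_geq_poly_eq0 _ _ s).
- apply/allP => t /mapP[i _ ->]; apply/rootP/H.
  rewrite divr_gt0 ?ltr0n //= ltr_pdivrMr ?ltr0n // ltr_pMr // ltr1n //.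
- rewrite map_inj_uniq ?iota_uniq // => i j /(mulfI (lt0r_neq0 c0)) /invr_inj /eqP.
  by rewrite eqr_nat => /eqP [].
- by rewrite size_map size_iota.
Qed.

Lemma poly_eq0_fun (P : {poly R}) : (forall t, P.[t] = 0) -> P = 0.
Proof. by move=> H; apply: (poly_eq0_itv ltr01) => t _; apply: H. Qed.

Lemma msize_mderiv p i : (mpoly.msize (mpoly.mderiv i p) <= (mpoly.msize p).-1)%N.
Proof.
rewrite mpoly.mmeasureE; apply/bigmax_leqP_seq => m mp _.
move: mp; rewrite mpoly.mcoeff_msupp mpoly.mcoeff_mderiv => h.
have : mpoly.mnm_add m (mpoly.mnm1 i) \in mpoly.msupp p.
  by rewrite mpoly.mcoeff_msupp; apply: contraNneq h => ->; rewrite mul0rn.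
by move=> /mpoly.msize_mdeg_lt; rewrite mpoly.mdegD mpoly.mdeg1 addn1 ltn_predRL.
Qed.

Lemma mderiv0_const p : (forall i, mpoly.mderiv i p = 0) ->
  exists c, p = mpoly.mpolyC n c.
Proof.
move=> H; exists (mpoly.mcoeff (@mpoly.mnm0 n) p); apply/mpoly.mpolyP => m.
rewrite mpoly.mcoeffC; case: eqP => [->|/eqP m0]; first by rewrite mulr1.
rewrite mulr0.
have [i mi] : exists i, m i != 0%N.
  apply/existsP; apply: contraNT m0; rewrite negb_exists => /forallP m0.
  by apply/eqP/mpoly.mnmP => i; rewrite mpoly.mnm0E; apply/eqP; have := m0 i; rewrite negbK.
have := congr1 (mpoly.mcoeff (mpoly.mnm_sub m (mpoly.mnm1 i))) (H i).
rewrite mpoly.mcoeff_mderiv mpoly.submK; last by rewrite mpoly.lep1mP.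
rewrite mpoly.mcoeff0 => /eqP; rewrite mulrn_eq0 /= => /eqP -> //.
Qed.

(** The partial derivatives of a polynomial function that vanishes everywhere vanish
everywhere too, and have smaller degree; so by induction they are zero, and the
polynomial is constant. *)
Lemma eval_eq0 p : (forall x, mpoly_eval x p = 0) -> p = 0.
Proof.
have [k] := ubnP (mpoly.msize p); elim: k p => // k IH p pk H.
have dp i : mpoly.mderiv i p = 0.
  have [p0|p0] := eqVneq p 0; first by rewrite p0 mpoly.mderiv0.
  apply: IH.
    apply: (leq_ltn_trans (msize_mderiv p i)).
    have p_gt0 : (0 < mpoly.msize p)%N by rewrite lt0n mpoly.msize_poly_eq0.
    by rewrite prednK.
  move=> x; have [P [P1 P2]] := line_polyP p x (delta_mx 0 i).
  have P0 : P = 0 by apply: poly_eq0_fun => t; rewrite P1 H.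
  have := P2 0; rewrite P0 deriv0 horner0 (bigD1 i) //= big1 => [|j ji].
    by rewrite addr0 scale0r addr0 mxE !eqxx mul1r => <-.
  by rewrite mxE eqxx (negbTE ji) mul0r.
have [c pc] := mderiv0_const dp.
by have := H 0; rewrite pc evalC => ->; rewrite mpoly.mpolyC0.
Qed.

Lemma eval_inj p q : (forall x, mpoly_eval x p = mpoly_eval x q) -> p = q.
Proof.
move=> H; apply/eqP; rewrite -subr_eq0; apply/eqP/eval_eq0 => x.
by rewrite evalB H subrr.
Qed.

End PolynomialFunctions.

(** * Divisibility by powers of affine forms *)

Section Divisibility.
Variables (R : realType) (n : nat).
Implicit Types a b c : poly_ R n.

Definition divides a b := exists c : poly_ R n, b = a * c.

Lemma divides0 a : divides a 0.
Proof. by exists 0; rewrite mulr0. Qed.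
Lemma dividesD a b c : divides a b -> divides a c -> divides a (b + c).
Proof. by move=> [u ->] [v ->]; exists (u + v); rewrite mulrDr. Qed.
Lemma dividesMl a b c : divides a b -> divides a (c * b).
Proof. by move=> [u ->]; exists (c * u); rewrite mulrCA. Qed.
Lemma divides_sum (I : finType) a (F : I -> poly_ R n) :
  (forall i, divides a (F i)) -> divides a (\sum_i F i).
Proof. by move=> H; elim/big_ind: _ => //; [exact: divides0|exact: dividesD]. Qed.
End Divisibility.

Section Hyperplanes.
Variables (R : realType) (n : nat).
Implicit Types (p q l h u : poly_ R n) (x y v : 'rV[R]_n).

Lemma msizeM_leq p q a b : (mpoly.msize p <= a)%N -> (mpoly.msize q <= b)%N ->
  (mpoly.msize (p * q) <= (a + b).-1)%N.
Proof.
move=> pa qb; have [->|p0] := eqVneq p 0; first by rewrite mul0r mpoly.mmeasure0.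
have [->|q0] := eqVneq q 0; first by rewrite mulr0 mpoly.mmeasure0.
by rewrite mpoly.msizeM // -!subn1 leq_sub2r // leq_add.
Qed.

(** A bound of the shape [d.+1 - e], with truncated subtraction, says that a coefficient
has degree at most d - e, and is zero if e > d; this is how the degree of a
coefficient is bounded in terms of the degree e of a basis element. *)
Lemma msizeM_filtered p q d e : (mpoly.msize p <= d.+1 - e)%N ->
  (mpoly.msize q <= e.+1)%N -> (mpoly.msize (p * q) <= d.+1)%N.
Proof.
move=> pd qe; case: (leqP e d) => [ed|de].
  by apply: (leq_trans (msizeM_leq pd qe)); lia.
move: pd; have -> : (d.+1 - e = 0)%N by lia.
by rewrite leqn0 mpoly.msize_poly_eq0 => /eqP ->; rewrite mul0r mpoly.mmeasure0.
Qed.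

Lemma msizeD_leq p q a : (mpoly.msize p <= a)%N -> (mpoly.msize q <= a)%N ->
  (mpoly.msize (p + q) <= a)%N.
Proof.
by move=> pa qa; apply: (leq_trans (mpoly.msizeD_le _ _)); rewrite geq_max pa qa.
Qed.

Lemma msizeB_leq p q a : (mpoly.msize p <= a)%N -> (mpoly.msize q <= a)%N ->
  (mpoly.msize (p - q) <= a)%N.
Proof. by move=> pa qa; rewrite msizeD_leq // mpoly.mmeasureN. Qed.

Lemma msize_sum_leq (I : Type) (s : seq I) (P : pred I) (F : I -> poly_ R n) a :
  (forall i, P i -> (mpoly.msize (F i) <= a)%N) ->
  (mpoly.msize (\sum_(i <- s | P i) F i) <= a)%N.
Proof.
move=> H; elim/big_ind: _ => //; first by rewrite mpoly.mmeasure0.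
by move=> p q; exact: msizeD_leq.
Qed.

Lemma msizeZ_leq (c : R) p a :
  (mpoly.msize p <= a)%N -> (mpoly.msize (c *: p) <= a)%N.
Proof. by apply: leq_trans; exact: mpoly.msizeZ_le. Qed.

(** The functional equation, which mentions no coefficients, gives at once the values
on lines and, through differences, the linear part. *)
Definition affine_form l := (mpoly.msize l <= 2)%N /\
  forall x y z t, mpoly_eval (x + t *: (y - z)) l =
    mpoly_eval x l + t * (mpoly_eval y l - mpoly_eval z l).

Lemma affine_formC c : affine_form (mpoly.mpolyC n c).
Proof.
split; first by rewrite mpoly.mmeasureC; case: eqP.
by move=> x y z t; rewrite !evalC subrr mulr0 addr0.
Qed.

Lemma affine_formX i : affine_form (mvar R i).
Proof.
split; first by rewrite mpoly.msizeX mpoly.mdeg1.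
by move=> x y z t; rewrite !evalX !mxE.
Qed.

Lemma affine_formD l h : affine_form l -> affine_form h -> affine_form (l + h).
Proof.
move=> [l2 lE] [h2 hE]; split; first exact: msizeD_leq.
by move=> x y z t; rewrite !evalD lE hE; ring.
Qed.

Lemma affine_formZ c l : affine_form l -> affine_form (c *: l).
Proof.
move=> [l2 lE]; split; first exact: msizeZ_leq.
by move=> x y z t; rewrite !evalZ lE; ring.
Qed.

Lemma affine_formB l h : affine_form l -> affine_form h -> affine_form (l - h).
Proof. by move=> la ha; rewrite -scaleN1r; apply/affine_formD/affine_formZ. Qed.

Lemma affine_form_sum (I : finType) (F : I -> poly_ R n) :
  (forall i, affine_form (F i)) -> affine_form (\sum_i F i).
Proof.
move=> H; elim/big_ind: _ => //; last exact: affine_formD.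
by rewrite -(mpoly.mpolyC0 n R); exact: affine_formC.
Qed.

Variable l : poly_ R n.
Hypothesis l_aff : affine_form l.
Hypothesis l_unit : exists x y, mpoly_eval x l != mpoly_eval y l.

Lemma affine_form_direction :
  exists e, forall x t, mpoly_eval (x + t *: e) l = mpoly_eval x l + t.
Proof.
have [x [y xy]] := l_unit; exists ((mpoly_eval x l - mpoly_eval y l)^-1 *: (x - y)).
move=> z t; rewrite scalerA l_aff.2 -mulrA mulVf ?mulr1 // subr_eq0 //.
Qed.

Lemma affine_form_neq0 : l != 0.
Proof. by apply/eqP => l0; have [x [y]] := l_unit; rewrite l0 !eval0 eqxx. Qed.

(** If e is a direction along which l grows with slope 1, then x - l(x) e is the
projection of x to the hyperplane l = 0, and q(x) - q(x - l(x) e) is a multiple of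
l(x) for every polynomial q. *)
Lemma divides_affine_form q :
  (forall x, mpoly_eval x l = 0 -> mpoly_eval x q = 0) -> divides l q.
Proof.
move=> q0; have [e eE] := affine_form_direction.
have [h hE] : exists h, forall x, mpoly_eval x q -
    mpoly_eval (x - mpoly_eval x l *: e) q = mpoly_eval x l * mpoly_eval x h.
  elim/mpoly_ring_ind: (q) => [c|i|p1 p2 [h1 H1] [h2 H2]|p1 p2 [h1 H1] [h2 H2]].
  - by exists 0 => x; rewrite eval0 !evalC mulr0 subrr.
  - exists (mpoly.mpolyC n (e 0 i)) => x; rewrite !evalX evalC !mxE; ring.
  - by exists (h1 + h2) => x; rewrite !evalD mulrDr -H1 -H2; ring.
  - exists (p1 * h2 + (p2 - l * h2) * h1) => x.
    rewrite !evalM evalD !evalM evalB evalM.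
    have -> : mpoly_eval x l *
       (mpoly_eval x p1 * mpoly_eval x h2 +
        (mpoly_eval x p2 - mpoly_eval x l * mpoly_eval x h2) * mpoly_eval x h1) =
      mpoly_eval x p1 * (mpoly_eval x l * mpoly_eval x h2) +
      (mpoly_eval x p2 - mpoly_eval x l * mpoly_eval x h2) *
        (mpoly_eval x l * mpoly_eval x h1) by ring.
    rewrite -H1 -H2; ring.
exists h; apply: eval_inj => x; rewrite evalM -hE [X in _ - X]q0 ?subr0 //.
by rewrite -scaleNr eE subrr.
Qed.

(** On a line within the hyperplane l = 0 that starts at b, the product of the
restrictions of u and h vanishes, while that of u does not. *)
Lemma affine_form_prime u h b :
    mpoly_eval b l = 0 -> mpoly_eval b u != 0 -> divides l (u * h) ->
  divides l h.
Proof.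
move=> b0 ub [w uhE]; apply: divides_affine_form => x x0.
have [U [UE _]] := line_polyP u b (x - b); have [H [HE _]] := line_polyP h b (x - b).
have UH0 : U * H = 0.
  apply: poly_eq0_fun => t; rewrite hornerM UE HE -evalM uhE evalM.
  by rewrite l_aff.2 b0 x0 subrr mulr0 addr0 mul0r.
have : H.[1] = mpoly_eval x h by rewrite HE scale1r addrC subrK.
move/eqP: UH0; rewrite mulf_eq0 => /orP[/eqP U0|/eqP ->]; last by rewrite horner0.
by move: ub; have := UE 0; rewrite U0 horner0 scale0r addr0 => <-; rewrite eqxx.
Qed.

Lemma affine_form_primeX m u h b :
    mpoly_eval b l = 0 -> mpoly_eval b u != 0 -> divides (l ^+ m) (u * h) ->
  divides (l ^+ m) h.
Proof.
move=> b0 ub; elim: m h => [|m IH] h; first by exists h; rewrite mul1r.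
move=> [w wE]; have [g hE] : divides l h.
  by apply: (affine_form_prime b0 ub); exists (l ^+ m * w); rewrite mulrA -exprS.
have [|k gE] := IH g.
  exists w; apply: (mulfI affine_form_neq0).
  by rewrite [RHS]mulrA -exprS -wE hE mulrCA.
by exists k; rewrite hE gE exprS mulrA.
Qed.

End Hyperplanes.

Section Flatness.
Variables (R : realType) (n : nat).
Implicit Types (p q l h u : poly_ R n) (X : set 'rV[R]_n).

(** All partial derivatives of q of order at most r vanish on X. *)
Fixpoint flat (r : nat) X q : Prop :=
  (forall x, X x -> mpoly_eval x q = 0) /\
  if r is r'.+1 then forall i : 'I_n, flat r' X (mpoly.mderiv i q) else True.

Lemma flatW r X q : flat r.+1 X q -> flat r X q.
Proof.
elim: r q => [|r IH] q [q0 dq]; first by split.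
by split=> // i; apply: IH.
Qed.

(** With q = l^r h by induction, differentiate along a direction of slope 1: l^r divides
the derivative of q, whose term of lowest order in l is r l^(r-1) h. *)
Lemma flat_divides r X q l :
    affine_form l -> (exists x y, mpoly_eval x l != mpoly_eval y l) ->
    (forall p, (forall x, X x -> mpoly_eval x p = 0) ->
       forall x, mpoly_eval x l = 0 -> mpoly_eval x p = 0) ->
  flat r X q -> divides (l ^+ r.+1) q.
Proof.
move=> l_aff l_unit XH; elim: r q => [|r IH] q fq.
  by rewrite expr1; apply: divides_affine_form => //; apply: XH; case: fq.
have [h qE] := IH q (flatW fq).
have [e eE] := affine_form_direction l_aff l_unit.
pose De p := \sum_i e 0 i *: mpoly.mderiv i p.
have DeM p p' : De (p * p') = De p * p' + p * De p'.
  rewrite /De mulr_suml mulr_sumr -big_split; apply: eq_bigr => i _ /=.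
  by rewrite mpoly.mderivM scalerDr scalerAl scalerAr.
have Del : De l = 1.
  apply: eval_inj => x; have [P [P1 P2]] := line_polyP l x e.
  have PE : P = (mpoly_eval x l)%:P + 'X.
    apply/eqP; rewrite -subr_eq0; apply/eqP/poly_eq0_fun => t.
    by rewrite !hornerE P1 eE subrr.
  have := P2 0; rewrite PE derivD derivC derivX add0r hornerC scale0r addr0 => dE.
  by rewrite eval1 [RHS]dE eval_sum; apply: eq_bigr => i _; rewrite evalZ.
have DelX k : De (l ^+ k.+1) = k.+1%:R * l ^+ k.
  elim: k => [|k IHk]; first by rewrite expr1 Del expr0 mulr1.
  by rewrite exprS DeM Del IHk mul1r mulrCA -exprS -[in RHS]add1n natrD mulrDl mul1r.
have [w wE] : divides (l ^+ r.+1) (De q).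
  apply: divides_sum => i; case: fq => _ /(_ i) /IH [w ->].
  by exists (e 0 i *: w); rewrite scalerAr.
have [v hE] : divides l h.
  exists (r.+1%:R^-1 *: (w - De h)).
  have : l ^+ r * (l * (w - De h)) = l ^+ r * (r.+1%:R * h).
    rewrite qE DeM DelX in wE.
    have -> : l ^+ r * (l * (w - De h)) = l ^+ r.+1 * w - l ^+ r.+1 * De h.
      by rewrite exprSr; ring.
    rewrite -wE; ring.
  have lr0 : l ^+ r != 0 by rewrite expf_neq0 // affine_form_neq0.
  move=> /(mulfI lr0) H.
  by rewrite -scalerAr H mulr_natl -(@scaler_nat R _ r.+1 h) scalerA mulVf ?scale1r // pnatr_eq0.
by exists v; rewrite qE hE [in RHS]exprSr -mulrA.
Qed.

Lemma divides_flat r X q l :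
    (forall x, X x -> mpoly_eval x l = 0) -> divides (l ^+ r.+1) q ->
  flat r X q.
Proof.
move=> X0; elim: r q => [|r IH] q [w ->].
  by split=> // x Xx; rewrite expr1 evalM X0 ?mul0r.
split=> [x Xx|i]; first by rewrite evalM evalXn X0 // expr0n mul0r.
apply: IH; rewrite mpoly.mderivM; apply: dividesD; last first.
  by exists (l * mpoly.mderiv i w); rewrite mulrA -exprSr.
rewrite mulrC; apply: dividesMl; elim: (r.+1) => [|k IHk].
  rewrite expr1 expr0; exists (mpoly.mderiv i l); by rewrite mul1r.
rewrite [l ^+ k.+2]exprS mpoly.mderivM; apply: dividesD.
  by rewrite mulrC; exists (mpoly.mderiv i l).
by have [c ->] := IHk; exists c; rewrite [in RHS]exprS mulrA.
Qed.

End Flatness.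

(** * Antiderivatives of products of linear factors *)

(** The substitution t = b + (a - b) s turns the factors t - a and t - b into multiples of
a - b; one more factor a - b comes from dt. *)
Lemma deriv_comp_segment (A : comNzRingType) (P h : {poly A}) (a b : A) i j :
    P^`() = ('X - a%:P) ^+ i * ('X - b%:P) ^+ j * h ->
  exists V, (P \Po (b%:P + (a - b)%:P * 'X))^`() =
    ((a - b) ^+ (i + j).+1)%:P * V.
Proof.
move=> dP; set L := (X in P \Po X); exists (('X - 1) ^+ i * 'X^j * (h \Po L)).
have aL : ('X - a%:P) \Po L = (a - b)%:P * ('X - 1).
  rewrite comp_polyB comp_polyX comp_polyC mulrBr mulr1 [in X in _ = _ - X]polyCB opprB.
  by rewrite /L [b%:P + _]addrC addrA.
have bL : ('X - b%:P) \Po L = (a - b)%:P * 'X.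
  by rewrite comp_polyB comp_polyX comp_polyC /L addrC addKr.
have dL : L^`() = (a - b)%:P.
  by rewrite /L derivD derivC derivM derivC derivX mul0r mulr1 !add0r.
rewrite deriv_comp dP dL !comp_polyM !rmorphXn /= aL bL.
by rewrite !exprMn exprS exprD; ring.
Qed.

Section Antiderivative.
Variables (R : realType) (N : nat).
Notation S := (poly_ R N).
Implicit Types (P Q : {poly S}) (a b : S).

Definition antideriv P : {poly S} :=
  \poly_(i < (size P).+1) ((i%:R^-1 : R) *: P`_(i.-1)).

Lemma deriv_antideriv P : (antideriv P)^`() = P.
Proof.
apply/polyP => i; rewrite coef_deriv coef_poly ltnS.
case: ltnP => [_|iP]; last by rewrite mul0rn nth_default.
rewrite /= -(@scaler_nat R _ i.+1) scalerA mulfV ?scale1r // pnatr_eq0.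
Qed.

Lemma deriv_eq0 P : P^`() = 0 -> P = (P`_0)%:P.
Proof.
move=> P0; apply/polyP => -[|i]; first by rewrite coefC.
rewrite coefC /=; have := congr1 (fun Q : {poly S} => Q`_i) P0.
rewrite coef_deriv coef0 -(@scaler_nat R _ i.+1) => /eqP.
by rewrite mpoly.mscalerI pnatr_eq0 => /eqP.
Qed.

(** The difference is the integral of the derivative from b to a, taken along
b + (a - b) s for s from 0 to 1. *)
Lemma divides_antideriv P a b (i j : nat) (h : {poly S}) :
    P^`() = ('X - a%:P) ^+ i * ('X - b%:P) ^+ j * h ->
  divides ((a - b) ^+ (i + j).+1) (P.[a] - P.[b]).
Proof.
move=> dP; pose L : {poly S} := b%:P + (a - b)%:P * 'X.
have [V VE] : exists V : {poly S},
    (P \Po L)^`() = ((a - b) ^+ (i + j).+1)%:P * V := deriv_comp_segment dP.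
pose U : {poly S} := P \Po L - ((a - b) ^+ (i + j).+1)%:P * antideriv V.
have U0 : U^`() = 0.
  by rewrite derivB VE derivM derivC mul0r add0r deriv_antideriv subrr.
have H t : P.[b + (a - b) * t] = U`_0 + (a - b) ^+ (i + j).+1 * (antideriv V).[t].
  have : U.[t] = U`_0 by rewrite {1}(deriv_eq0 U0) hornerC.
  rewrite hornerD hornerN hornerM hornerC horner_comp => <-.
  by rewrite hornerD hornerM !hornerC hornerX subrK.
exists ((antideriv V).[1] - (antideriv V).[0]).
have := H 1; rewrite mulr1 [b + _]addrC subrK => ->.
have := H 0; rewrite mulr0 addr0 => ->.
by rewrite mulrBr opprD addrACA subrr add0r.
Qed.

(** The total degree in t and in the variables is at most d. *)
Definition total_degree_leq (d : nat) P :=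
  forall i, (mpoly.msize P`_i <= d.+1 - i)%N.

Lemma total_degreeM d e P Q : total_degree_leq d P -> total_degree_leq e Q ->
  total_degree_leq (d + e) (P * Q).
Proof.
move=> Pd Qe k; rewrite coefM; apply: msize_sum_leq => i _.
have ik : (i <= k)%N by rewrite -ltnS.
case: (leqP i d) => [id|di]; last first.
  have := Pd i; have -> : (d.+1 - i)%N = 0%N by lia.
  by rewrite leqn0 mpoly.msize_poly_eq0 => /eqP ->; rewrite mul0r mpoly.mmeasure0.
case: (leqP (k - i) e) => [ie|ei]; last first.
  have := Qe (k - i)%N; have -> : (e.+1 - (k - i))%N = 0%N by lia.
  by rewrite leqn0 mpoly.msize_poly_eq0 => /eqP ->; rewrite mulr0 mpoly.mmeasure0.
by apply: (leq_trans (msizeM_leq (Pd i) (Qe _))); lia.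
Qed.

Lemma total_degree1 : total_degree_leq 0 1.
Proof.
by case=> [|i]; rewrite coef1 ?mpoly.msize1 ?mpoly.mmeasure0.
Qed.

Lemma total_degree_exp d P k :
  total_degree_leq d P -> total_degree_leq (k * d) (P ^+ k).
Proof.
move=> Pd; elim: k => [|k IH]; first by rewrite expr0; exact: total_degree1.
by rewrite exprS mulSn; apply: total_degreeM.
Qed.

Lemma total_degree_prod (I : finType) (A : pred I) (F : I -> {poly S}) :
  (forall i, A i -> total_degree_leq 1 (F i)) ->
  total_degree_leq #|A| (\prod_(i | A i) F i).
Proof.
move=> H; rewrite -sum1_card; elim/big_ind2: _ => //.
  exact: total_degree1.
by move=> d P e Q; apply: total_degreeM.
Qed.

Lemma total_degreeX : total_degree_leq 1 'X.
Proof.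
by case=> [|[|i]]; rewrite coefX /= ?mpoly.msize1 ?mpoly.mmeasure0.
Qed.

Lemma total_degree_XsubC a :
  (mpoly.msize a <= 2)%N -> total_degree_leq 1 ('X - a%:P).
Proof.
move=> a2 [|[|i]]; rewrite coefB coefX coefC /= ?sub0r ?subr0.
- by rewrite mpoly.mmeasureN.
- by rewrite mpoly.msize1.
- by rewrite oppr0 mpoly.mmeasure0.
Qed.

Lemma total_degree_antideriv d P :
  total_degree_leq d P -> total_degree_leq d.+1 (antideriv P).
Proof.
move=> Pd i; rewrite coef_poly; case: ifP => _; last by rewrite mpoly.mmeasure0.
case: i => [|i]; first by rewrite invr0 scale0r mpoly.mmeasure0.
by rewrite subSS; apply: msizeZ_leq; exact: Pd.
Qed.

Lemma msize_exp_leq a k : (mpoly.msize a <= 2)%N ->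
  (mpoly.msize (a ^+ k) <= k.+1)%N.
Proof.
move=> a2; elim: k => [|k IH]; first by rewrite expr0 mpoly.msize1.
by rewrite exprS; apply: (leq_trans (msizeM_leq a2 IH)).
Qed.

Lemma msize_horner_leq d P a : total_degree_leq d P -> (mpoly.msize a <= 2)%N ->
  (mpoly.msize P.[a] <= d.+1)%N.
Proof.
move=> Pd a2; rewrite horner_coef; apply: msize_sum_leq => i _.
exact: (msizeM_filtered (Pd i) (msize_exp_leq i a2)).
Qed.

End Antiderivative.

Section RolleRoots.
Variables (R : realType) (n : nat) (y : 'I_n.+1 -> R).
Hypothesis y_incr : forall a b : 'I_n.+1, (a < b)%N -> y a < y b.

(** Between two consecutive zeros of P there is a zero of its derivative, which is not
one of the y a and hence is a zero of the cofactor c. *)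
Lemma rolle_roots (P c : {poly R}) (e : nat) :
    (forall a, P.[y a] = 0) -> P^`() = (\prod_a ('X - (y a)%:P)) ^+ e * c ->
  exists s : seq R, [/\ size s = n, uniq s, all (root c) s &
    forall a, y a \notin s].
Proof.
move=> P0 dP.
pose lo (i : 'I_n) : 'I_n.+1 := widen_ord (leqnSn n) i.
pose hi (i : 'I_n) : 'I_n.+1 := lift ord0 i.
have y_leq (a b : 'I_n.+1) : (a <= b)%N -> y a <= y b.
  rewrite leq_eqVlt => /orP[/eqP /val_inj -> //|ab]; exact/ltW/y_incr.
have /fin_all_exists [xi xiP] : forall i : 'I_n, exists t,
    (y (lo i) < t < y (hi i)) /\ P^`().[t] = 0.
  move=> i; have lt : y (lo i) < y (hi i) by apply: y_incr; rewrite /= /bump.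
  have [t tI t0] := polyrcf.poly_rolle lt (etrans (P0 _) (esym (P0 _))).
  by exists t; split => //; move: tI; rewrite in_itv.
have sep a i : y a != xi i.
  have [/andP[l h] _] := xiP i; case: (leqP a (lo i)) => [ai|ia].
    by rewrite lt_eqF // (le_lt_trans (y_leq _ _ ai)).
  by rewrite gt_eqF // (lt_le_trans h) // y_leq.
have xi_inj : injective xi.
  have H (i j : 'I_n) : (i < j)%N -> xi i < xi j.
    move=> ij; have [/andP[_ h] _] := xiP i; have [/andP[l _] _] := xiP j.
    by apply: (lt_le_trans h); apply/(le_trans _ (ltW l))/y_leq.
  move=> i j ij; case: (ltngtP (i : 'I_n) (j : 'I_n)) => [/H|/H|/val_inj //];
    by rewrite ij ltxx.
exists (codom xi); split.
- by rewrite size_codom card_ord.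
- exact/injectiveP.
- apply/allP => t /codomP[i ->]; have [_] := xiP i.
  rewrite dP hornerM horner_exp horner_prod => /eqP; rewrite mulf_eq0 => /orP[|//].
  rewrite expf_eq0 => /andP[_ /prodf_eq0 [a _]].
  by rewrite hornerXsubC subr_eq0 eq_sym (negbTE (sep a i)).
- by move=> a; apply/codomP => -[i /eqP]; rewrite (negbTE (sep a i)).
Qed.

End RolleRoots.

(** * The module of a braid arrangement *)

Section BraidCoordinates.
Variables (R : realType) (N m : nat).
Implicit Types v : 'I_m.+1 -> poly_ R N.

(** Affine forms whose differences take arbitrary values, subject only to the relations
that differences satisfy.  Only these differences matter, so the forms themselves may
be dependent: the n + 1 scaled barycentric coordinates in n-space qualify. *)
Definition braid_coordinates v :=
  (forall a, affine_form (v a)) /\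
  forall t : 'I_m.+1 -> R, exists x, forall a b,
    mpoly_eval x (v a) - mpoly_eval x (v b) = t a - t b.

Lemma wall_nonconstant v a b : braid_coordinates v -> a != b ->
  exists x x', mpoly_eval x (v a - v b) != mpoly_eval x' (v a - v b).
Proof.
move=> [_ v_surj] ab; have [x xE] := v_surj (fun=> 0).
have [x' xE'] := v_surj (fun l => (l == a)%:R).
exists x', x; rewrite !evalB xE xE' subrr eqxx [b == a]eq_sym (negbTE ab) subr0.
exact: oner_neq0.
Qed.

End BraidCoordinates.

Section BraidModule.
Variables (R : realType) (N n r : nat) (z : 'I_n.+1 -> poly_ R N).
Notation S := (poly_ R N).
Hypothesis z_braid : braid_coordinates z.

Let z_aff := z_braid.1.
Let z_surj := z_braid.2.

Definition braid_module (q : 'I_n.+1 -> S) :=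
  forall a b, divides ((z a - z b) ^+ r.+1) (q a - q b).

Let lo (j : 'I_n) : 'I_n.+1 := widen_ord (leqnSn n) j.

(** For odd r the integrand must vanish to order r./2 + 1 at one of any two of the z l,
which multiplication by this factor achieves. *)
Definition braid_factor (j : 'I_n) : {poly S} :=
  if odd r then \prod_(l | l != lo j) ('X - (z l)%:P) else 'X^j.

Definition braid_primitive (j : 'I_n) : {poly S} :=
  antideriv ((\prod_l ('X - (z l)%:P)) ^+ r./2 * braid_factor j).

Definition braid_theta (j : 'I_n) (a : 'I_n.+1) : S := (braid_primitive j).[z a].

Definition braid_exponent (j : nat) : nat :=
  r./2 * n.+1 + (if odd r then n.+1 else j.+1).

Definition braid_basis (j a : 'I_n.+1) : S :=
  oapp (braid_theta^~ a) 1 (unlift ord0 j).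

Definition braid_degree (j : 'I_n.+1) : nat :=
  oapp (fun j' : 'I_n => braid_exponent j') 0%N (unlift ord0 j).

Let collect_left (A : comNzRingType) (x y g c : A) e :
  x ^+ e * y ^+ e * g ^+ e * (x * c) = x ^+ e.+1 * y ^+ e * (g ^+ e * c).
Proof. by rewrite exprS; ring. Qed.

Let collect_right (A : comNzRingType) (x y g c : A) e :
  x ^+ e * y ^+ e * g ^+ e * (y * c) = x ^+ e * y ^+ e.+1 * (g ^+ e * c).
Proof. by rewrite exprS; ring. Qed.

Lemma braid_theta_module j : braid_module (braid_theta j).
Proof.
move=> a b; have [->|ab] := eqVneq a b; first by rewrite [X in divides _ X]subrr; exact: divides0.
pose g := \prod_(l | (l != a) && (l != b)) ('X - (z l)%:P).
have gE : \prod_l ('X - (z l)%:P) = ('X - (z a)%:P) * ('X - (z b)%:P) * g.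
  by rewrite (bigD1 a) //= (bigD1 b) 1?eq_sym //= mulrA.
rewrite /braid_theta; have := deriv_antideriv
  ((\prod_l ('X - (z l)%:P)) ^+ r./2 * braid_factor j).
rewrite -/(braid_primitive j) gE !exprMn /braid_factor.
have rE : r = (odd r + (r./2 + r./2))%N by rewrite addnn odd_double_half.
rewrite [X in divides (_ ^+ X.+1)]rE; case: (odd r) => dP.
- have [aj|aj] := eqVneq a (lo j).
  + have bj : b != lo j by rewrite -aj eq_sym.
    have dP' : (braid_primitive j)^`() = ('X - (z a)%:P) ^+ r./2 *
        ('X - (z b)%:P) ^+ r./2.+1 *
        (g ^+ r./2 * \prod_(l | (l != lo j) && (l != b)) ('X - (z l)%:P)).
      by rewrite dP (bigD1 b) //=; exact: collect_right.
    by have := divides_antideriv dP'; rewrite addnS.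
  + have dP' : (braid_primitive j)^`() = ('X - (z a)%:P) ^+ r./2.+1 *
        ('X - (z b)%:P) ^+ r./2 *
        (g ^+ r./2 * \prod_(l | (l != lo j) && (l != a)) ('X - (z l)%:P)).
      by rewrite dP (bigD1 a) //=; exact: collect_left.
    by have := divides_antideriv dP'.
- have dP' : (braid_primitive j)^`() = ('X - (z a)%:P) ^+ r./2 *
      ('X - (z b)%:P) ^+ r./2 * (g ^+ r./2 * 'X^j) by rewrite dP mulrA.
  exact: divides_antideriv dP'.
Qed.

Lemma braid_basis_module j : braid_module (braid_basis j).
Proof.
rewrite /braid_basis; case: unliftP => [j' _|_] a b; first exact: braid_theta_module.
by rewrite [X in divides _ X]subrr; exact: divides0.
Qed.

Lemma msize_braid_theta j a :
  (mpoly.msize (braid_theta j a) <= (braid_exponent j).+1)%N.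
Proof.
apply: msize_horner_leq; last by have [] := z_aff a.
have XzP l : true -> total_degree_leq 1 ('X - (z l)%:P).
  by move=> _; apply: total_degree_XsubC; have [] := z_aff l.
have HP : total_degree_leq (r./2 * n.+1) ((\prod_l ('X - (z l)%:P)) ^+ r./2).
  apply: total_degree_exp; have := total_degree_prod XzP.
  by rewrite (_ : #|xpredT| = n.+1) // -[RHS](card_ord n.+1).
rewrite /braid_exponent /braid_primitive /braid_factor; case: ifP => _.
  rewrite addnS; apply/total_degree_antideriv/total_degreeM => //.
  have := @total_degree_prod R N _ (predC1 (lo j)) _ (fun l _ => XzP l isT).
  by rewrite cardC1 card_ord.
rewrite addnS; apply/total_degree_antideriv/total_degreeM => //.
by rewrite -[j in total_degree_leq j]muln1; apply/total_degree_exp/total_degreeX.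
Qed.

Lemma msize_braid_basis j a :
  (mpoly.msize (braid_basis j a) <= (braid_degree j).+1)%N.
Proof.
rewrite /braid_basis /braid_degree; case: unliftP => [j' _|_] /=.
  exact: msize_braid_theta.
by rewrite mpoly.msize1.
Qed.

Definition braid_matrix : 'M[S]_n.+1 := \matrix_(a, j) braid_basis j a.

Let incr_point : exists x, forall a b : 'I_n.+1, (a < b)%N ->
  mpoly_eval x (z a) < mpoly_eval x (z b).
Proof.
have [x xE] := z_surj (fun a => a%:R); exists x => a b ab.
by rewrite -subr_gt0 xE subr_gt0 ltr_nat.
Qed.

(** At a point where the values y a of the forms increase, a linear relation between the
columns of the matrix yields a univariate P that vanishes at all y a and whose
derivative is a product of the powers of the linear factors with a combination c of
the braid factors.  By Rolle's theorem c has more roots than its degree allows, so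
c = 0, and the coefficients of the relation vanish. *)
Lemma braid_det_neq0 : exists x, mpoly_eval x (\det braid_matrix) != 0.
Proof.
have [x incr] := incr_point; exists x.
pose f : {rmorphism S -> R} := mpoly.meval (fun i => x 0 i).
pose y a := mpoly_eval x (z a).
rewrite /mpoly_eval -[mpoly.meval _ _]/(f _) -det_map_mx -det_tr.
apply/det0P => -[v v0 vM].
have vM' a : v 0 ord0 + \sum_(j < n) v 0 (lift ord0 j) * f (braid_theta j a) = 0.
  have := congr1 (fun A : 'rV_n.+1 => A 0 a) vM.
  rewrite !mxE big_ord_recl !mxE /braid_basis unlift_none /= rmorph1 mulr1 => vMa.
  by rewrite -[RHS]vMa; congr (_ + _); apply: eq_bigr => j _; rewrite !mxE /braid_basis liftK.
pose cR j : {poly R} := map_poly f (braid_factor j).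
pose P : {poly R} := (v 0 ord0)%:P +
  \sum_(j < n) (v 0 (lift ord0 j))%:P * map_poly f (braid_primitive j).
pose c : {poly R} := \sum_(j < n) (v 0 (lift ord0 j))%:P * cR j.
have P0 a : P.[y a] = 0.
  rewrite -[RHS](vM' a) /P hornerD hornerC horner_sum; congr (_ + _).
  by apply: eq_bigr => j _; rewrite hornerM hornerC horner_map.
have mapX l : map_poly f ('X - (z l)%:P) = 'X - (y l)%:P.
  by rewrite rmorphB /= map_polyX map_polyC.
have dP : P^`() = (\prod_a ('X - (y a)%:P)) ^+ r./2 * c.
  rewrite /P derivD derivC add0r raddf_sum /c mulr_sumr; apply: eq_bigr => j _.
  rewrite /= derivM derivC mul0r add0r deriv_map deriv_antideriv rmorphM rmorphXn.
  by rewrite rmorph_prod /= (eq_bigr _ (fun l _ => mapX l)) mulrCA.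
have [s [sn us rs ys]] := rolle_roots incr P0 dP.
have y_inj : injective y.
  have H (i j : 'I_n.+1) : (i < j)%N -> y i != y j by move=> /incr h; rewrite lt_eqF.
  move=> i j ij; case: (ltngtP i j) => [/H|/H|/val_inj //]; by rewrite ij eqxx.
have vj0 j : v 0 (lift ord0 j) = 0.
  have cRE j' : cR j' = if odd r then \prod_(l | l != lo j') ('X - (y l)%:P)
                        else 'X^j'.
    rewrite /cR /braid_factor; case: ifP => _; last by rewrite map_polyXn.
    by rewrite rmorph_prod /= (eq_bigr _ (fun l _ => mapX l)).
  case/boolP: (odd r) => rodd.
  - have szc : (size c <= n.+1)%N.
      apply: (leq_trans (size_sum _ _ _)); apply/bigmax_leqP => j' _.
      rewrite cRE rodd mul_polyC; apply: (leq_trans (size_scale_leq _ _)).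
      by rewrite -big_filter size_prod_XsubC -sum1_size big_filter sum1_card cardC1 card_ord.
    have c0 : c = 0.
      (* every braid factor also vanishes at the last point, as lo j is never maximal *)
      apply: (@roots_geq_poly_eq0 _ _ (y ord_max :: s)); last by rewrite /= sn.
        rewrite /= rs andbT; apply/rootP; rewrite horner_sum big1 // => j' _.
        rewrite hornerM cRE rodd horner_prod (bigD1 ord_max) /=; last first.
          by rewrite -val_eqE /= gtn_eqF.
        by rewrite hornerXsubC subrr mul0r mulr0.
      by rewrite /= ys us.
    have := congr1 (fun p : {poly R} => p.[y (lo j)]) c0.
    rewrite horner0 horner_sum (bigD1 j) //= big1 => [|j' j'j]; last first.
      rewrite hornerM cRE rodd horner_prod (bigD1 (lo j)) /=.
        by rewrite hornerXsubC subrr mul0r mulr0.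
      by rewrite -val_eqE /= eq_sym.
    rewrite addr0 hornerM hornerC cRE rodd horner_prod => /eqP.
    rewrite mulf_eq0 => /orP[/eqP //|/prodf_eq0 [l lj]].
    by rewrite hornerXsubC subr_eq0 => /eqP /y_inj jl; rewrite jl eqxx in lj.
  - have c0 : c = 0.
      apply: (@roots_geq_poly_eq0 _ _ s) => //; rewrite sn.
      apply: (leq_trans (size_sum _ _ _)); apply/bigmax_leqP => j' _.
      rewrite cRE (negbTE rodd) mul_polyC; apply: (leq_trans (size_scale_leq _ _)).
      by rewrite size_polyXn.
    have := congr1 (fun p : {poly R} => p`_j) c0.
    rewrite coef0 coef_sum (bigD1 j) //= big1 => [|j' j'j]; last first.
      rewrite cRE (negbTE rodd) mul_polyC coefZ coefXn eq_sym.
      by rewrite val_eqE (negbTE j'j) mulr0.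
    by rewrite cRE (negbTE rodd) mul_polyC coefZ coefXn eqxx mulr1 addr0.
case/eqP: v0; apply/rowP => j; rewrite mxE.
case: (unliftP ord0 j) => [j' ->|->]; first exact: vj0.
by have := vM' ord0; rewrite big1 ?addr0 // => j' _; rewrite vj0 mul0r.
Qed.

(** Rows of the matrix are indexed by the forms: subtracting row b from row a produces a
row of multiples of the power of z a - z b. *)
Lemma divides_det (M : 'M[S]_n.+1) :
    (forall j, braid_module (fun a => M a j)) -> forall a b, a != b ->
  divides ((z a - z b) ^+ r.+1) (\det M).
Proof.
move=> MD a b ab; pose d := (z a - z b) ^+ r.+1.
have /fin_all_exists [w wE] : forall j, exists w : S, M a j - M b j = d * w.
  by move=> j; exact: MD.
pose C := \matrix_(i, j) (if i == a then M b j else M i j).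
pose W := \matrix_(i, j) (if i == a then w j else M i j).
rewrite (@determinant_multilinear _ _ M W C a d 1).
- have -> : \det C = 0.
    apply: (determinant_alternate ab) => j.
    by rewrite !mxE eqxx eq_sym (negbTE ab).
  by rewrite mulr0 addr0; exists (\det W).
- by apply/rowP => j; rewrite !mxE eqxx -wE mul1r subrK.
- by apply/matrixP => i j; rewrite !mxE eq_sym (negbTE (neq_lift _ _)).
- by apply/matrixP => i j; rewrite !mxE eq_sym (negbTE (neq_lift _ _)).
Qed.

Definition braid_product : S :=
  \prod_(p : 'I_n.+1 * 'I_n.+1 | (p.1 < p.2)%N) (z p.1 - z p.2) ^+ r.+1.

(** The factors are powers of pairwise non-associated affine forms.  A common witness is
a point where z p.1 and z p.2 agree and all other differences are not zero. *)
Lemma divides_braid_product (F : S) :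
    (forall a b, a != b -> divides ((z a - z b) ^+ r.+1) F) ->
  divides braid_product F.
Proof.
move=> H; rewrite /braid_product -big_filter.
set s := seq.filter _ _; have : uniq s by rewrite filter_uniq // index_enum_uniq.
have : forall p : 'I_n.+1 * 'I_n.+1, p \in s -> (p.1 < p.2)%N.
  by move=> p; rewrite mem_filter => /andP[].
elim: s => [|p s IH] ps /=; first by rewrite big_nil; exists F; rewrite mul1r.
have ps' (q : 'I_n.+1 * 'I_n.+1) : q \in s -> (q.1 < q.2)%N.
  by move=> qs; apply: ps; rewrite inE qs orbT.
move=> /andP[pNs us]; have [h FE] := IH ps' us.
have p12 := ps p (mem_head _ _).
have p12' : p.1 != p.2 by rewrite neq_ltn p12.
pose v (l : 'I_n.+1) : nat := if l == p.2 then p.1 else l.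
have [x xE] := z_surj (fun l => (v l)%:R).
suff [k hE] : divides ((z p.1 - z p.2) ^+ r.+1) h.
  by exists k; rewrite FE hE big_cons mulrA [_ * (_ ^+ _)]mulrC.
apply: (affine_form_primeX (affine_formB (z_aff _) (z_aff _)) (wall_nonconstant z_braid p12')
  (b := x) _ _ (u := \prod_(q <- s) (z q.1 - z q.2) ^+ r.+1)).
- by rewrite evalB xE /v eqxx (negbTE p12') subrr.
- rewrite /mpoly_eval rmorph_prod prodf_seq_neq0; apply/allP => q qs /=.
  rewrite rmorphXn expf_eq0 negb_and /=.
  have q12 := ps' q qs.
  rewrite -/(mpoly_eval x _) evalB xE subr_eq0 eqr_nat /v.
  case: ifP => [/eqP q1|_]; case: ifP => [/eqP q2|q2].
  + by move: q12; rewrite q1 q2 ltnn.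
  + by rewrite q1 in q12; rewrite neq_ltn (ltn_trans p12 q12).
  + apply: contraNneq pNs => q1; rewrite (_ : p = q) //.
    by apply/eqP; rewrite -pair_eqE /pair_eq q2 eqxx andbT -val_eqE /= q1.
  + by rewrite neq_ltn q12.
- by rewrite -FE; exact: H.
Qed.

Lemma braid_degree_sum : (\sum_j braid_degree j = r.+1 * 'C(n.+1, 2))%N.
Proof.
rewrite big_ord_recl /braid_degree unlift_none add0n /=.
rewrite (eq_bigr (fun j : 'I_n => braid_exponent j)) => [|j _]; last by rewrite liftK.
rewrite big_split sum_nat_const card_ord /=.
have bE : (n.+1 * n = 'C(n.+1, 2) + 'C(n.+1, 2))%N.
  by have := mul_bin_diag n.+1 1; rewrite bin1 addnn -mul2n.
have -> : (n * (r./2 * n.+1) = r./2 * ('C(n.+1, 2) + 'C(n.+1, 2)))%N.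
  by rewrite -bE; lia.
have rE : r = (odd r + (r./2 + r./2))%N by rewrite addnn odd_double_half.
rewrite [X in _ = (X.+1 * _)%N]rE; case: (odd r) => /=.
  rewrite sum_nat_const card_ord [(n * _)%N]mulnC bE; lia.
have -> : (\sum_(i < n) i.+1 = 'C(n.+1, 2))%N.
  by rewrite -bin2_sum big_mkord big_ord_recl add0n.
lia.
Qed.

Lemma msize_braid_product :
  mpoly.msize braid_product = (\sum_j braid_degree j).+1.
Proof.
have card_pairs :
    size [seq p : 'I_n.+1 * 'I_n.+1 <- index_enum _ | (p.1 < p.2)%N] =
    'C(n.+1, 2).
  rewrite -sum1_size big_filter.
  rewrite -(pair_big_dep xpredT (fun i j : 'I_n.+1 => (i < j)%N) (fun _ _ => 1%N)) /=.
  rewrite (exchange_big_dep xpredT) //= -bin2_sum big_mkord; apply: eq_bigr => j _.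
  rewrite sum1_card -[RHS](card_ord j).
  have jn : (j <= n.+1)%N by rewrite ltnW.
  have inj : injective (widen_ord jn) by move=> i i' /(congr1 val) /= /val_inj.
  rewrite -[RHS](card_imset predT inj).
  apply: eq_card => i; apply/idP/imsetP => [ij|[i' _ ->]]; last first.
    exact: (ltn_ord i').
  exists (Ordinal (ij : (i < j)%N)) => //; exact/val_inj.
rewrite braid_degree_sum -card_pairs /braid_product -big_filter.
set s := seq.filter _ _.
have : forall p : 'I_n.+1 * 'I_n.+1, p \in s -> (p.1 < p.2)%N.
  by move=> p; rewrite mem_filter => /andP[].
elim: s => [|p s IH] ps; first by rewrite big_nil muln0 mpoly.msize1.
have p12 : p.1 != p.2 by rewrite neq_ltn ps ?mem_head.
have z12 := affine_formB (z_aff p.1) (z_aff p.2).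
have z0 := affine_form_neq0 (wall_nonconstant z_braid p12).
have z2 : mpoly.msize (z p.1 - z p.2) = 2.
  apply/eqP; rewrite eqn_leq z12.1 /= ltnNge; apply/negP => /mpoly.msize1_polyC zE.
  by have [x [y]] := wall_nonconstant z_braid p12; rewrite zE !evalC eqxx.
have zX k : mpoly.msize ((z p.1 - z p.2) ^+ k) = k.+1.
  elim: k => [|k IHk]; first by rewrite expr0 mpoly.msize1.
  by rewrite exprS mpoly.msizeM ?expf_neq0 // z2 IHk.
have IH' : mpoly.msize (\prod_(i <- s) (z i.1 - z i.2) ^+ r.+1) =
    (r.+1 * size s).+1.
  by apply: IH => q qs; apply: ps; rewrite inE qs orbT.
rewrite big_cons mpoly.msizeM ?expf_neq0 //; last first.
  by rewrite -mpoly.msize_poly_eq0 IH'.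
by rewrite zX IH' /= mulnS addSn addnS.
Qed.

Lemma msize_det (w : 'I_n.+1 -> nat) (M : 'M[S]_n.+1) :
    (forall a j, (mpoly.msize (M a j) <= (w j).+1)%N) ->
  (mpoly.msize (\det M) <= (\sum_j w j).+1)%N.
Proof.
move=> Mw; apply: msize_sum_leq => s _.
have H : (mpoly.msize (\prod_i M i (s i)) <= (\sum_i w (s i)).+1)%N.
  elim/big_ind2: _ => //; first by rewrite mpoly.msize1.
  by move=> p a q b pa qb; apply: (leq_trans (msizeM_leq pa qb)); rewrite addnS addSn.
rewrite [X in (_ <= X.+1)%N](reindex_inj (@perm_inj _ s)) /=.
by case: (odd_perm s); rewrite ?expr0 ?expr1 ?mul1r ?mulN1r ?mpoly.mmeasureN.
Qed.

(** The determinant is divisible by [braid_product] and its degree is at most the degree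
of that product. *)
Lemma braid_det : exists2 k : R, k != 0 & \det braid_matrix = k *: braid_product.
Proof.
have [h hE] : divides braid_product (\det braid_matrix).
  apply/divides_braid_product/divides_det => j a b.
  by rewrite !mxE; exact: braid_basis_module.
have det0 : \det braid_matrix != 0.
  by apply/eqP => d0; have [x] := braid_det_neq0; rewrite d0 eval0 eqxx.
have Q0 : braid_product != 0 by rewrite -mpoly.msize_poly_eq0 msize_braid_product.
have h0 : h != 0 by apply: contraNneq det0 => h0; rewrite hE h0 mulr0.
have /mpoly.msize1_polyC hC : (mpoly.msize h <= 1)%N.
  have : (mpoly.msize (\det braid_matrix) <= (\sum_j braid_degree j).+1)%N.
    by apply: msize_det => a j; rewrite mxE; exact: msize_braid_basis.
  rewrite hE mpoly.msizeM // msize_braid_product addSn /= -[X in (_ <= X)%N]addn1.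
  by rewrite leq_add2l.
exists (mpoly.mcoeff (@mpoly.mnm0 N) h).
  by apply: contraNneq h0 => c0; rewrite hC c0 mpoly.mpolyC0.
by rewrite hE {1}hC mulrC mpoly.mul_mpolyC.
Qed.

(** Cramer's rule: the coefficients are the quotients of determinants, the numerators of
which are divisible by [braid_product] as their columns belong to the module.  The
same quotients bound the degrees of the coefficients. *)
Lemma braid_module_span (q : 'I_n.+1 -> S) : braid_module q ->
  exists2 c : 'I_n.+1 -> S,
    forall a, q a = \sum_j c j * braid_basis j a &
    forall d, (forall a, (mpoly.msize (q a) <= d.+1)%N) ->
      forall j, (mpoly.msize (c j) <= d.+1 - braid_degree j)%N.
Proof.
move=> qD; have [k k0 kE] := braid_det.
pose M j : 'M[S]_n.+1 := \matrix_(a, j') (if j' == j then q a else braid_basis j' a).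
have /fin_all_exists [h hE] : forall j, divides braid_product (\det (M j)).
  move=> j; apply/divides_braid_product/divides_det => j' a b; rewrite !mxE.
  case: eqP => _; [exact: qD|exact: braid_basis_module].
have Q0 : braid_product != 0 by rewrite -mpoly.msize_poly_eq0 msize_braid_product.
have det0 : \det braid_matrix != 0.
  by apply/eqP => d0; have [x] := braid_det_neq0; rewrite d0 eval0 eqxx.
have adjE : \adj braid_matrix *m (\col_a q a) = \col_j \det (M j).
  apply/colP => j; rewrite !mxE (expand_det_col _ j); apply: eq_bigr => a _.
  rewrite !mxE eqxx mulrC; congr (_ * ((-1) ^+ _ * \det _)).
  apply/matrixP => a' j'; rewrite !mxE eq_sym (negbTE (neq_lift _ _)) //.
exists (fun j => k^-1 *: h j) => [a|d qd j].
  have := mul_mx_adj braid_matrix; move/(congr1 (mulmx^~ (\col_a q a))).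
  rewrite -mulmxA adjE mul_scalar_mx => /(congr1 (fun A : 'cV_n.+1 => A a 0)).
  rewrite !mxE => dE; apply: (mulfI det0); rewrite -[LHS]dE mulr_sumr.
  apply: eq_bigr => j _; rewrite !mxE hE kE -scalerAl -[k^-1 *: _ * _]scalerAl.
  by rewrite -scalerAr scalerA mulfV // scale1r mulrC -mulrA.
apply: msizeZ_leq; have [->|h0] := eqVneq (h j) 0; first by rewrite mpoly.mmeasure0.
pose w j' := if j' == j then d else braid_degree j'.
have := @msize_det w (M j); rewrite hE mpoly.msizeM // msize_braid_product.
have wE : (\sum_j' w j' + braid_degree j = d + \sum_j' braid_degree j')%N.
  rewrite (bigD1 j) //= [in RHS](bigD1 j) //= /w eqxx.
  rewrite (eq_bigr braid_degree) => [|j' /negbTE -> //].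
  by rewrite -addnA; congr (_ + _)%N; rewrite addnC.
move=> /(_ _)/wrap[].
  move=> a j'; rewrite mxE /w; case: eqP => _; [exact: qd|exact: msize_braid_basis].
have : (0 < mpoly.msize (h j))%N by rewrite lt0n mpoly.msize_poly_eq0.
move: wE; rewrite addSn /=; move: (mpoly.msize (h j)) (braid_degree j) => s b.
by move: (\sum_j' w j')%N (\sum_j' braid_degree j')%N => A B; lia.
Qed.

Lemma braid_basis_free (c : 'I_n.+1 -> S) :
  (forall a, \sum_j c j * braid_basis j a = 0) -> forall j, c j = 0.
Proof.
move=> c0.
have det0 : \det braid_matrix != 0.
  by apply/eqP => d0; have [x] := braid_det_neq0; rewrite d0 eval0 eqxx.
have Mc : braid_matrix *m (\col_j c j) = 0.
  apply/colP => a; rewrite !mxE -[RHS](c0 a); apply: eq_bigr => j _.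
  by rewrite !mxE mulrC.
move=> j; have := mul_adj_mx braid_matrix; move/(congr1 (mulmx^~ (\col_a c a))).
rewrite -mulmxA Mc mulmx0 mul_scalar_mx => /(congr1 (fun A : 'cV_n.+1 => A j 0)).
by rewrite !mxE => /esym/eqP; rewrite mulf_eq0 (negbTE det0) => /eqP.
Qed.

End BraidModule.

(** * Gluing braid modules *)

Section FlatClosure.
Variables (R : realType) (N : nat).
Implicit Types (X : set 'rV[R]_N) (p q : poly_ R N).

Lemma flatD r X p q : flat r X p -> flat r X q -> flat r X (p + q).
Proof.
elim: r p q => [|r IH] p q [p0 dp] [q0 dq]; split=> //.
- by move=> x Xx; rewrite evalD p0 // q0 // addr0.
- by move=> x Xx; rewrite evalD p0 // q0 // addr0.
- by move=> i; rewrite mpoly.mderivD; apply: IH; [exact: dp|exact: dq].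
Qed.

Lemma flatMl r X p q : flat r X q -> flat r X (p * q).
Proof.
elim: r p q => [|r IH] p q fq; case: (fq) => q0 dq; split=> //.
- by move=> x Xx; rewrite evalM q0 // mulr0.
- by move=> x Xx; rewrite evalM q0 // mulr0.
- by move=> i; rewrite mpoly.mderivM; apply: flatD; apply: IH; [exact: flatW|exact: dq].
Qed.

Lemma flat0 r X : flat r X 0.
Proof.
elim: r => [|r IH]; split=> //; try by move=> x _; rewrite eval0.
by move=> i; rewrite mpoly.mderiv0.
Qed.

Lemma flat_sum (I : finType) r X (F : I -> poly_ R N) :
  (forall i, flat r X (F i)) -> flat r X (\sum_i F i).
Proof. by move=> H; elim/big_ind: _ => //; [exact: flat0|exact: flatD]. Qed.

(** Pieces that agree to order r wherever their cells meet.  Pairs of cells that meet in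
a face of small dimension are included. *)
Definition compatible (I : Type) (X : I -> set 'rV[R]_N) r (p : I -> poly_ R N) :=
  forall c c', flat r (X c `&` X c') (p c - p c').

Lemma compatible_sum (I : Type) (J : finType) (X : I -> set 'rV[R]_N) r (c : J -> poly_ R N)
    (B : J -> I -> poly_ R N) : (forall j, compatible X r (B j)) ->
  compatible X r (fun i => \sum_j c j * B j i).
Proof.
move=> BX i i'; rewrite -sumrB; apply: flat_sum => j.
by rewrite -mulrBr; apply: flatMl; exact: BX.
Qed.

End FlatClosure.

Section Refinement.
Variables (R : realType) (N k n : nat).
Notation S := (poly_ R N).
Variables (X : 'I_k.+1 * 'I_n.+1 -> set 'rV[R]_N).
Variables (z : 'I_k.+1 -> S) (y : 'I_k.+1 -> 'I_n.+1 -> S).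
Variable rho : 'I_k.+1 -> 'I_k.+1 -> 'I_n.+1.

(** The set Y is large enough in the hyperplane l = 0 for the values on Y to determine
a polynomial on the hyperplane. *)
Definition spans_wall (Y : set 'rV[R]_N) (l : S) :=
  forall p, (forall x, Y x -> mpoly_eval x p = 0) ->
    forall x, mpoly_eval x l = 0 -> mpoly_eval x p = 0.

(** The combinatorics of a split refined once more.  The cells (i, a) subdivide the outer
cell i.  The forms z govern the outer walls, the forms y i those within the outer
cell i, and rho i j is the subcell of i that is adjacent to the outer cell j.  The
ties say on which hyperplanes the intersections of cells lie. *)
Record braid_refinement : Prop := BraidRefinement {
  outer_braid : braid_coordinates z;
  inner_braid : forall i, braid_coordinates (y i);
  outer_tie : forall i j a b x, i != j -> X (i, a) x -> X (j, b) x ->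
    mpoly_eval x (z i) = mpoly_eval x (z j);
  mixed_tie : forall i j a b x, i != j -> X (i, a) x -> X (j, b) x ->
    mpoly_eval x (y i a) = mpoly_eval x (y i (rho i j));
  inner_tie : forall i a b x, X (i, a) x -> X (i, b) x ->
    mpoly_eval x (y i a) = mpoly_eval x (y i b);
  far_tie : forall l i j a b x, l != i -> l != j -> X (i, a) x -> X (j, b) x ->
    mpoly_eval x (y l (rho l i)) = mpoly_eval x (y l (rho l j));
  inner_wall : forall i a b, a != b ->
    spans_wall (X (i, a) `&` X (i, b)) (y i a - y i b);
  outer_wall : forall i j, i != j ->
    spans_wall (X (i, rho i j) `&` X (j, rho j i)) (z i - z j) }.

Hypothesis X_refines : braid_refinement.
Variable r : nat.

(** A family of pieces on the outer cell i, extended to each outer cell j by the piece of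
the subcell of i adjacent to j. *)
Definition extend (i : 'I_k.+1) (s : 'I_n.+1 -> S) (c : 'I_k.+1 * 'I_n.+1) : S :=
  s (if c.1 == i then c.2 else rho i c.1).

(** The labels on the left stand for the splines on the outer split, with the constant family;
those on the right for the splines on one subdivided outer cell, modulo polynomials. *)
Definition spline_label : finType := ('I_k.+1 + 'I_k.+1 * 'I_n)%type.

Definition spline_basis (J : spline_label) (c : 'I_k.+1 * 'I_n.+1) : S :=
  match J with
  | inl j => braid_basis r z j c.1
  | inr (i, j) => extend i (braid_theta r (y i) j) c
  end.

Definition spline_degree (J : spline_label) : nat :=
  match J with
  | inl j => @braid_degree k r j
  | inr (_, j) => braid_exponent n r j
  end.

Let z_aff := (outer_braid X_refines).1.
Let y_aff i := (inner_braid X_refines i).1.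

Lemma msize_spline_basis J c :
  (mpoly.msize (spline_basis J c) <= (spline_degree J).+1)%N.
Proof.
case: J => [j|[i j]] /=; first exact: (msize_braid_basis r (outer_braid X_refines)).
exact: (msize_braid_theta r (inner_braid X_refines i)).
Qed.

Lemma braid_module_flat m (v : 'I_m.+1 -> S) q a b Y : braid_module r v q ->
    (forall x, Y x -> mpoly_eval x (v a) = mpoly_eval x (v b)) ->
  flat r Y (q a - q b).
Proof.
move=> qv vY; apply: (divides_flat _ (qv a b)) => x Yx.
by rewrite evalB vY // subrr.
Qed.

Lemma extend_compatible i s : braid_module r (y i) s -> compatible X r (extend i s).
Proof.
move=> sy [j a] [j' b]; apply: (braid_module_flat sy) => x [/= xa xb].
rewrite /=; have [ji|ji] := eqVneq j i; have [j'i|j'i] := eqVneq j' i.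
- by apply: (inner_tie X_refines (x := x)); rewrite -ji // ji -j'i.
- by rewrite -ji; apply: (mixed_tie X_refines _ xa xb); rewrite ji eq_sym.
- apply/esym; rewrite -j'i.
  by apply: (mixed_tie X_refines _ xb xa); rewrite j'i eq_sym.
- by apply: (far_tie X_refines _ _ xa xb); rewrite eq_sym.
Qed.

Lemma spline_basis_compatible J : compatible X r (spline_basis J).
Proof.
case: J => [j|[i j]]; last exact/extend_compatible/braid_theta_module.
move=> [i a] [i' b]; have [->|ii'] := eqVneq i i'.
  by rewrite /= subrr; exact: flat0.
apply: (braid_module_flat (braid_basis_module r z j)) => x [xa xb].
exact: (outer_tie X_refines ii' xa xb).
Qed.

(** On the outer cell i the pieces form an element of the module of y i.  Subtracting the
extensions of its part modulo constants, for all i, leaves a family q that does not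
depend on the subcell, so that q belongs to the module of z. *)
Lemma spline_basis_span p : compatible X r p ->
  exists2 C : spline_label -> S,
    forall c, p c = \sum_J C J * spline_basis J c &
    forall d, (forall c, (mpoly.msize (p c) <= d.+1)%N) ->
      forall J, (mpoly.msize (C J) <= d.+1 - spline_degree J)%N.
Proof.
move=> pX.
have /fin_all_exists [s sP] : forall i : 'I_k.+1, exists s : 'I_n.+1 -> S,
    (forall a, p (i, a) = \sum_j s j * braid_basis r (y i) j a) /\
    forall d, (forall a, (mpoly.msize (p (i, a)) <= d.+1)%N) ->
      forall j, (mpoly.msize (s j) <= d.+1 - @braid_degree n r j)%N.
  move=> i; have [|s sE sd] :=
    @braid_module_span R N n r (y i) (inner_braid X_refines i) (fun a => p (i, a)).
    move=> a b; have [->|ab] := eqVneq a b.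
      by rewrite [X in divides _ X]subrr; exact: divides0.
    have y_unit := wall_nonconstant (inner_braid X_refines i) ab.
    apply: (flat_divides (affine_formB (y_aff i a) (y_aff i b)) y_unit
      (inner_wall X_refines ab)); exact: pX.
  by exists s.
pose g i c := \sum_(j < n) s i (lift ord0 j) * extend i (braid_theta r (y i) j) c.
pose q i := s i ord0 - \sum_(l | l != i) g l (i, ord0).
have gE i l a : l != i -> g l (i, a) = g l (i, ord0).
  by move=> li; apply: eq_bigr => j _; rewrite /extend /= eq_sym (negbTE li).
have pE i a : p (i, a) = q i + \sum_l g l (i, a).
  rewrite (sP i).1 big_ord_recl /braid_basis unlift_none /= mulr1 /q.
  have gS : \sum_(l | l != i) g l (i, a) = \sum_(l | l != i) g l (i, ord0).
    by apply: eq_bigr => l; exact: gE.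
  rewrite [X in _ = _ + X](bigD1 i) //= gS.
  rewrite addrCA addrNK addrC; congr (_ + _).
  by apply: eq_bigr => j _; rewrite liftK /extend eqxx.
have [C0 C0E C0d] : exists2 C0 : 'I_k.+1 -> S,
    forall i, q i = \sum_j C0 j * braid_basis r z j i &
    forall d, (forall i, (mpoly.msize (q i) <= d.+1)%N) ->
      forall j, (mpoly.msize (C0 j) <= d.+1 - @braid_degree k r j)%N.
  apply: (braid_module_span (outer_braid X_refines)) => i i'; have [->|ii'] := eqVneq i i'.
    by rewrite [X in divides _ X]subrr; exact: divides0.
  have z_unit := wall_nonconstant (outer_braid X_refines) ii'.
  apply: (flat_divides (affine_formB (z_aff i) (z_aff i')) z_unit
    (outer_wall X_refines ii')).
  have -> : q i - q i' = (p (i, rho i i') - p (i', rho i' i)) +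
      -1 * (\sum_l (g l (i, rho i i') - g l (i', rho i' i))).
    by rewrite !pE sumrB mulN1r; ring.
  apply: flatD; first exact: pX.
  apply/flatMl/flat_sum => l; rewrite /g -sumrB; apply: flat_sum => j.
  rewrite -mulrBr; apply: flatMl.
  exact: (extend_compatible (braid_theta_module r (y l) j)).
exists (fun J => match J with inl j => C0 j | inr (i, j) => s i (lift ord0 j) end).
  move=> [i a]; rewrite big_sumType /= -C0E pE; congr (_ + _).
  rewrite /g pair_bigA /=; apply: eq_bigr => -[l j] _ //.
move=> d pd [j|[i j]] /=; last first.
  have := (sP i).2 d (fun a => pd (i, a)) (lift ord0 j).
  by rewrite /braid_degree liftK.
apply: C0d => i; have -> : q i = p (i, ord0) - \sum_l g l (i, ord0).
  by rewrite pE addrK.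
apply: msizeB_leq => //; apply: msize_sum_leq => l _; apply: msize_sum_leq => j' _.
have := (sP l).2 d (fun a => pd (l, a)) (lift ord0 j').
rewrite /braid_degree liftK => sd; apply: (msizeM_filtered sd).
exact: (msize_braid_theta r (inner_braid X_refines l)).
Qed.

(** On the outer cell i, all terms but those with label (i, j) are independent of the
subcell, hence are absorbed by the constant family of the basis for y i. *)
Lemma spline_basis_free (C : spline_label -> S) :
  (forall c, \sum_J C J * spline_basis J c = 0) -> forall J, C J = 0.
Proof.
move=> C0.
have Cr0 (i : 'I_k.+1) (j : 'I_n) : C (inr (i, j)) = 0.
  pose K := \sum_j C (inl j) * braid_basis r z j i +
    \sum_(l | l != i) \sum_j C (inr (l, j)) *
      extend l (braid_theta r (y l) j) (i, ord0).
  pose c (j : 'I_n.+1) := oapp (fun j' => C (inr (i, j'))) K (unlift ord0 j).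
  have := @braid_basis_free R N n r (y i) (inner_braid X_refines i) c _ (lift ord0 j).
  rewrite /c liftK; apply => a.
  rewrite big_ord_recl /= unlift_none /= /braid_basis unlift_none /= mulr1.
  rewrite -[RHS](C0 (i, a)) big_sumType /= -addrA; congr (_ + _).
  rewrite (eq_bigr (fun J : 'I_k.+1 * 'I_n => C (inr (J.1, J.2)) *
    extend J.1 (braid_theta r (y J.1) J.2) (i, a))); last by case.
  rewrite -(pair_bigA _ (fun l j => C (inr (l, j)) *
    extend l (braid_theta r (y l) j) (i, a))) /= [in RHS](bigD1 i) //= addrC.
  congr (_ + _); first by apply: eq_bigr => j' _; rewrite !liftK /extend eqxx.
  apply: eq_bigr => l li; apply: eq_bigr => j' _.
  by rewrite /extend /= eq_sym (negbTE li).
case=> [j|[i j]] //.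
apply: (@braid_basis_free R N k r z (outer_braid X_refines) (fun j => C (inl j))) => i.
rewrite -[RHS](C0 (i, ord0)) big_sumType /= [X in _ + X]big1 ?addr0 // => -[l j'] _.
by rewrite Cr0 mul0r.
Qed.

End Refinement.

(** * Smoothness of piecewise polynomial functions *)

Section PolynomialCalculus.
Variables (R : realType) (n : nat).
Implicit Types (p : poly_ R n) (x : 'rV[R]_n).

Lemma continuous_eval p : continuous (fun x => mpoly_eval x p).
Proof.
elim/mpoly_ring_ind: p => [c|i|p q cp cq|p q cp cq].
- by rewrite (funext (evalC c)); exact: cst_continuous.
- by rewrite (funext (evalX i)); exact: coord_continuous.
- rewrite (funext (fun x => evalD x p q)) => x.
  exact: (cvgD (cp x) (cq x)).
- rewrite (funext (fun x => evalM x p q)) => x.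
  exact: (cvgM (cp x) (cq x)).
Qed.

Lemma is_derive_eval p x (i : 'I_n) :
  is_derive x (delta_mx 0 i) (fun y => mpoly_eval y p)
    (mpoly_eval x (mpoly.mderiv i p)).
Proof.
elim/mpoly_ring_ind: p => [c|j|p q dp dq|p q dp dq].
- rewrite mpoly.mderivC eval0; rewrite (funext (evalC c)).
  exact: is_derive_cst.
- rewrite mderivU; rewrite (funext (evalX j)).
  have -> : mpoly_eval x (i == j)%:R = (delta_mx 0 i : 'rV[R]_n) 0 j.
    by rewrite mxE eqxx eq_sym /mpoly_eval rmorph_nat.
  have H : (fun h : R => h^-1 *: ((h *: delta_mx 0 i + x) 0 j - x 0 j)) @ 0^' -->
      (delta_mx 0 i : 'rV[R]_n) 0 j.
    apply: cvg_near_cst; near=> h.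
    have h0 : h != 0 by near: h; exact: nbhs_dnbhs_neq.
    by rewrite !mxE addrK /GRing.scale /= mulrA mulVf ?mul1r.
  by apply: DeriveDef; [apply/cvg_ex; eexists; exact: H|exact: cvg_lim H].
- rewrite mpoly.mderivD evalD (funext (fun y => evalD y p q)).
  exact: is_deriveD.
- rewrite mpoly.mderivM evalD !evalM (funext (fun y => evalM y p q)).
  apply: (is_derive_eq (is_deriveM dp dq)).
  by rewrite addrC /GRing.scale /= [X in X + _]mulrC.
Unshelve. all: by end_near.
Qed.

(** On a line through an interior point, the restriction of the polynomial vanishes on an
interval. *)
Lemma eval_eq0_interior (Y : set 'rV[R]_n) x (p : poly_ R n) :
  Y° x -> (forall v, Y v -> mpoly_eval v p = 0) -> p = 0.
Proof.
move=> Yx pY; apply: eval_eq0 => v; have [P [PE _]] := line_polyP p x (v - x).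
have lineC : (fun t : R => x + t *: (v - x)) @ (0 : R) --> x.
  have : (fun t : R => x + t *: (v - x)) @ 0 --> x + 0 *: (v - x).
    by apply: cvgD; [exact: cvg_cst|exact: scalel_continuous].
  by rewrite scale0r addr0.
have /nbhs_ballP [e /= e0 eY] := lineC _ Yx.
have P0 : P = 0.
  apply: (poly_eq0_itv e0) => t /andP[t0 te]; rewrite PE; apply/pY/eY.
  by rewrite /ball /= sub0r normrN gtr0_norm.
by have := PE 1; rewrite P0 horner0 scale1r addrC subrK => <-.
Qed.

End PolynomialCalculus.

Section PiecewisePolynomials.
Variables (R : realType) (n : nat) (I : finType) (E : complex R n I).
Notation A := (realization E).
Notation X := (fun c => hull (E c)).
Hypothesis X_closed : forall c, closed (X c).
Hypothesis X_regular : forall c, X c `<=` closure (X c)°.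
Implicit Types (f g : 'rV[R]_n -> R) (p : I -> poly_ R n).

Definition pieces f p := forall c x, X c x -> f x = mpoly_eval x (p c).

Let subA c : X c `<=` A.
Proof. by move=> x xc; exists c. Qed.

(** The function g agrees with the derivative of the piece in the interior of the cell
and, by continuity, on the closure of this interior. *)
Lemma derivative_pieces f p g (i : 'I_n) : pieces f p ->
    (forall x, A° x -> is_derive x (delta_mx 0 i) f (g x)) ->
    {within A, continuous g} ->
  pieces g (fun c => mpoly.mderiv i (p c)).
Proof.
move=> fp dg cg c x xc; have xcl := X_regular xc.
have gint y : (X c)° y -> g y = mpoly_eval y (mpoly.mderiv i (p c)).
  move=> yc; have yA : A° y by apply: (interiorS (@subA c)).
  have := near_eq_is_derive _ (dg y yA).
  move=> /(_ (fun y => mpoly_eval y (p c))) [|_ <-].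
    by near=> z; apply: fp; near: z; exact: yc.
  by have [_ ->] := is_derive_eval (p c) y i.
pose F := within (X c)° (nbhs x).
have FF : ProperFilter F.
  apply: Build_ProperFilter_ex => P FP.
  by have [z [zc Pz]] := xcl _ FP; exists z; exact: Pz.
have gx : g @ F --> g x.
  have /subspace_continuousP /(_ _ (subA xc)) gA := cg.
  apply: cvg_trans gA; apply: cvg_fmap2; apply: within_subset => y yc.
  exact: (subA (interior_subset yc)).
have gpx : g @ F --> mpoly_eval x (mpoly.mderiv i (p c)).
  have : (fun y => mpoly_eval y (mpoly.mderiv i (p c))) @ F -->
      mpoly_eval x (mpoly.mderiv i (p c)).
    apply: cvg_trans (@continuous_eval _ _ (mpoly.mderiv i (p c)) x).
    by apply: cvg_fmap2; exact: cvg_within.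
  by apply: cvg_trans; apply: near_eq_cvg; near=> y; apply/esym/gint; near: y; exact: withinT.
exact: (cvg_unique _ gx gpx).
Unshelve. all: by end_near.
Qed.

(** Derivatives of a piecewise polynomial function are piecewise polynomial, with the
derivatives of the pieces; being functions, they have one value where cells meet. *)
Lemma Cr_compatible r f p : pieces f p -> Cr A r f -> compatible X r p.
Proof.
move=> + + c c'; elim: r f p => [|r IH] f p fp [cf df]; split=> //.
- by move=> x [xc xc']; rewrite evalB -(fp c) // -(fp c') // subrr.
- by move=> x [xc xc']; rewrite evalB -(fp c) // -(fp c') // subrr.
- move=> i; have [g [dg gC]] := df i; rewrite mpoly.mderivB.
  apply: (IH g (fun c => mpoly.mderiv i (p c))) => //.
  by apply: (derivative_pieces fp dg); case: (r) gC => [|r'] [].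
Qed.

Lemma glue_pieces r p : compatible X r p -> exists f, pieces f p.
Proof.
move=> pX; exists (fun x => oapp (fun c => mpoly_eval x (p c)) 0 [pick c | `[< X c x >]]).
move=> c x xc; case: pickP => [c' /asboolP xc'|/(_ c)] /=; last first.
  by move=> /asboolP; contradiction.
have := pX c' c; case: (r) => [|r'] [H _]; apply/eqP; rewrite -subr_eq0 -evalB.
  by rewrite H.
by rewrite H.
Qed.

Lemma pieces_continuous f p : pieces f p -> {within A, continuous f}.
Proof.
move=> fp; apply/subspace_continuousP => x Ax.
apply/cvgrPdist_lt => e e0; rewrite near_withinE.
suff : \forall y \near x, forall c, X c y -> `|f x - f y| < e.
  by apply: filterS => y H [c _ yc]; exact: H yc.
have := @filter_forall _ I (fun c y => X c y -> `|f x - f y| < e) (nbhs x) _.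
apply => c.
have [xc|xc] := pselect (X c x); last first.
  have : nbhs x (~` X c) by apply: open_nbhs_nbhs; split => //; exact/closed_openC.
  by apply: filterS.
have /cvgrPdist_lt /(_ e e0) := @continuous_eval _ _ (p c) x.
by apply: filterS => y H yc; rewrite (fp c x) // (fp c y).
Qed.

(** Near x only cells that contain x matter, since cells are closed; for each of them the
difference quotient of f along points of the cell is that of a polynomial, whose
limit is g x. *)
Lemma pieces_derive f g p (i : 'I_n) x : pieces f p ->
    pieces g (fun c => mpoly.mderiv i (p c)) -> A° x ->
  is_derive x (delta_mx 0 i) f (g x).
Proof.
move=> fp gp Ax; pose v : 'rV[R]_n := delta_mx 0 i.
suff H : (fun h : R => h^-1 *: (f (h *: v + x) - f x)) @ 0^' --> g x.
  by apply: DeriveDef; [apply/cvg_ex; eexists; exact: H|exact: cvg_lim H].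
have lineC : (fun h : R => h *: v + x) @ 0^' --> x.
  have : (fun h : R => h *: v + x) @ 0 --> (0 : R) *: v + x.
    by apply: cvgD; [exact: scalel_continuous|exact: cvg_cst].
  by rewrite scale0r add0r => /cvg_within_filter; exact.
apply/cvgrPdist_lt => e e0.
have hA : \forall h \near (0 : R)^', A (h *: v + x).
  exact: lineC Ax.
have : \forall h \near (0 : R)^', forall c, X c (h *: v + x) ->
    `|g x - h^-1 *: (f (h *: v + x) - f x)| < e.
  have := @filter_forall _ I (fun c h => X c (h *: v + x) ->
    `|g x - h^-1 *: (f (h *: v + x) - f x)| < e) (0 : R)^' _.
  apply => c.
  have [xc|xc] := pselect (X c x); last first.
    have : nbhs x (~` X c) by apply: open_nbhs_nbhs; split => //; exact/closed_openC.
    move=> /lineC H; have {H} : \forall h \near (0 : R)^', ~ X c (h *: v + x) := H.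
    by apply: filterS.
  have [dp dpE] := is_derive_eval (p c) x i.
  have /cvgrPdist_lt /(_ e e0) : (fun h : R => h^-1 *:
      (mpoly_eval (h *: v + x) (p c) - mpoly_eval x (p c))) @ 0^' --> g x.
    by rewrite (gp c) // -dpE; exact: dp.
  by apply: filterS => h H hc; rewrite (fp c x) // (fp c (h *: v + x)).
move: hA; apply: filterS2 => h [c _ hc] H; exact: H hc.
Qed.

Lemma compatible_Cr r f p : pieces f p -> compatible X r p -> Cr A r f.
Proof.
elim: r f p => [|r IH] f p fp pX; split=> //; try exact: pieces_continuous fp.
move=> i; have dX : compatible X r (fun c => mpoly.mderiv i (p c)).
  by move=> c c'; have [_ /(_ i)] := pX c c'; rewrite mpoly.mderivB.
have [g gp] := glue_pieces dX; exists g; split; last exact: IH gp dX.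
by move=> x Ax; exact: pieces_derive gp Ax.
Qed.

End PiecewisePolynomials.

(** * Barycentric coordinates *)

Section Barycentric.
Variables (R : realType) (n : nat).
Notation S := (poly_ R n).
Implicit Types (x u w : 'rV[R]_n) (l : S).

Lemma affine_form_shift (I : finType) l (a : I -> R) (P : I -> 'rV[R]_n) x y :
  affine_form l -> mpoly_eval (x + \sum_i a i *: (P i - y)) l =
    mpoly_eval x l + \sum_i a i * (mpoly_eval (P i) l - mpoly_eval y l).
Proof.
move=> [_ lE]; elim: (index_enum I) x => [|i s IH] x; first by rewrite !big_nil !addr0.
by rewrite !big_cons addrA IH lE addrA.
Qed.

Lemma affine_form_comb (I : finType) l (a : I -> R) (P : I -> 'rV[R]_n) :
  affine_form l -> \sum_i a i = 1 ->
  mpoly_eval (\sum_i a i *: P i) l = \sum_i a i * mpoly_eval (P i) l.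
Proof.
move=> l_aff a1; have := affine_form_shift a P 0 0 l_aff; rewrite add0r.
under eq_bigr do rewrite subr0.
move=> ->; rewrite [X in _ + X](_ : _ = \sum_i a i * mpoly_eval (P i) l -
  \sum_i a i * mpoly_eval 0 l); last by rewrite -sumrB; apply: eq_bigr => i _; rewrite mulrBr.
by rewrite -mulr_suml a1 mul1r addrC subrK.
Qed.

Definition barycentric m (T : 'I_m -> 'rV[R]_n) (b : 'I_m -> S) : Prop :=
  [/\ forall j, affine_form (b j),
      forall i j, mpoly_eval (T i) (b j) = (i == j)%:R,
      forall x, \sum_j mpoly_eval x (b j) = 1
    & forall x, \sum_j mpoly_eval x (b j) *: T j = x].

Section Simplex.
Variables (m : nat) (T : 'I_m -> 'rV[R]_n) (b : 'I_m -> S).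
Hypothesis Tb : barycentric T b.

Lemma barycentric_comb (a : 'I_m -> R) j :
  \sum_i a i = 1 -> mpoly_eval (\sum_i a i *: T i) (b j) = a j.
Proof.
have [b_aff bT _ _] := Tb => a1; rewrite affine_form_comb //.
rewrite (bigD1 j) //= bT eqxx mulr1 big1 ?addr0 // => i ij.
by rewrite bT (negbTE ij) mulr0.
Qed.

Lemma hull_barycentric x : hull T x <-> forall j, 0 <= mpoly_eval x (b j).
Proof.
have [_ _ b1 bx] := Tb; split=> [[a [a0 a1 ->]] j|x0].
  by rewrite barycentric_comb.
by exists (fun j => mpoly_eval x (b j)).
Qed.

Lemma relint_barycentric x : relint T x -> forall j, 0 < mpoly_eval x (b j).
Proof. by move=> [a [a0 a1 ->]] j; rewrite barycentric_comb. Qed.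

Lemma closed_hull : closed (hull T).
Proof.
have -> : hull T = \bigcap_(j in [set: 'I_m])
    ((fun x => mpoly_eval x (b j)) @^-1` [set t | 0 <= t]).
  by apply/seteqP; split => x; [move/hull_barycentric => H j _|move=> H];
    [exact: H|apply/hull_barycentric => j; exact: H].
apply: closed_bigI => j _; apply: closed_comp; last exact: closed_ge.
by move=> x _; exact: continuous_eval.
Qed.

Lemma interior_hull x : (forall j, 0 < mpoly_eval x (b j)) -> (hull T)° x.
Proof.
move=> x0; rewrite /interior.
have : \forall y \near x, forall j, 0 < mpoly_eval y (b j).
  have := @filter_forall _ _ (fun j y => 0 < mpoly_eval y (b j)) (nbhs x) _.
  apply => j; exact: (@continuous_eval _ _ (b j) x _ (lt_nbhsr (x0 j))).
by apply: filterS => y y0; apply/hull_barycentric => j; exact: ltW.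
Qed.

(** Move a point of the simplex slightly towards the centroid. *)
Lemma regular_hull : (0 < m)%N -> hull T `<=` closure (hull T)°.
Proof.
move=> m0 x /hull_barycentric x0 U Ux.
pose c := \sum_(j < m) m%:R^-1 *: T j.
have cE j : mpoly_eval c (b j) = m%:R^-1.
  rewrite barycentric_comb // sumr_const card_ord -[LHS]mulr_natr mulVf //.
  by rewrite pnatr_eq0 -lt0n.
have lineC : (fun t : R => x + t *: (c - x)) @ 0^'+ --> x.
  have : (fun t : R => x + t *: (c - x)) @ 0 --> x + 0 *: (c - x).
    by apply: cvgD; [exact: cvg_cst|exact: scalel_continuous].
  by rewrite scale0r addr0 => /cvg_within_filter; exact.
have [t [t0 t1 Ut]] : exists t : R, [/\ 0 < t, t < 1 & U (x + t *: (c - x))].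
  have H : \forall t \near (0 : R)^'+, U (x + t *: (c - x)) := lineC _ Ux.
  have H2 : \forall t \near (0 : R)^'+, [/\ 0 < t, t < 1 & U (x + t *: (c - x))].
    near=> t; split; last by near: t.
    - by near: t; exact: nbhs_right_gt.
    - by near: t; exact: nbhs_right_lt.
  by have [t] := filter_ex H2; exists t.
exists (x + t *: (c - x)); split => //; apply: interior_hull => j.
have [b_aff _ _ _] := Tb; rewrite (b_aff j).2 cE.
have -> : mpoly_eval x (b j) + t * (m%:R^-1 - mpoly_eval x (b j)) =
  (1 - t) * mpoly_eval x (b j) + t * m%:R^-1 by ring.
apply: ltr_wpDl; first by rewrite mulr_ge0 // subr_ge0 ltW.
by rewrite mulr_gt0 // invr_gt0 ltr0n.
Unshelve. all: by end_near.
Qed.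

(** Barycentric coordinates after vertex a has been replaced by u: coordinate a becomes
the coefficient of u, and the others lose what u contributes. *)
Definition alfeld_barycentric u (a : 'I_m) (j : 'I_m) : S :=
  let t := (mpoly_eval u (b a))^-1 *: b a in
  if j == a then t else b j - mpoly_eval u (b j) *: t.

Lemma alfeld_barycentricP u a : mpoly_eval u (b a) != 0 ->
  barycentric (alfeld T u a) (alfeld_barycentric u a).
Proof.
have [b_aff bT b1 bx] := Tb => u0; set c := mpoly_eval u (b a) in u0.
have bE x j : j != a -> mpoly_eval x (alfeld_barycentric u a j) =
    mpoly_eval x (b j) - mpoly_eval u (b j) * (c^-1 * mpoly_eval x (b a)).
  by move=> ja; rewrite /alfeld_barycentric (negbTE ja) evalB !evalZ.
have bEa x : mpoly_eval x (alfeld_barycentric u a a) = c^-1 * mpoly_eval x (b a).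
  by rewrite /alfeld_barycentric eqxx evalZ.
split.
- move=> j; rewrite /alfeld_barycentric; case: ifP => _.
    exact: affine_formZ.
  by apply/affine_formB/affine_formZ/affine_formZ.
- move=> i j; rewrite /alfeld; have [->|ja] := eqVneq j a.
    rewrite bEa; case: eqP => [_|/eqP ia]; first by rewrite mulVf.
    by rewrite bT (negbTE ia) mulr0.
  rewrite bE //; have [->|ia] := eqVneq i a.
    by rewrite mulVf // mulr1 subrr eq_sym (negbTE ja).
  by rewrite !bT (negbTE ia) !mulr0 subr0.
- move=> x; rewrite (bigD1 a) //= bEa (eq_bigr (fun j => mpoly_eval x (b j) -
    mpoly_eval u (b j) * (c^-1 * mpoly_eval x (b a)))); last by move=> j; exact: bE.
  have xa : \sum_(j | j != a) mpoly_eval x (b j) = 1 - mpoly_eval x (b a).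
    by have := b1 x; rewrite (bigD1 a) //= => <-; rewrite [RHS]addrC addKr.
  have ua : \sum_(j | j != a) mpoly_eval u (b j) = 1 - c.
    by have := b1 u; rewrite (bigD1 a) //= => <-; rewrite [RHS]addrC addKr.
  rewrite sumrB -mulr_suml xa ua; clearbody c.
  by move: (mpoly_eval x (b a)) => t; field.
- move=> x; rewrite (bigD1 a) //= bEa /alfeld eqxx.
  rewrite (eq_bigr (fun j => mpoly_eval x (b j) *: T j -
    (c^-1 * mpoly_eval x (b a)) *: (mpoly_eval u (b j) *: T j))); last first.
    by move=> j ja; rewrite bE // (negbTE ja) scalerBl scalerA [_ * mpoly_eval u _]mulrC.
  have xa : \sum_(j | j != a) mpoly_eval x (b j) *: T j = x - mpoly_eval x (b a) *: T a.
    by have := bx x; rewrite (bigD1 a) //= => /esym xE; rewrite [X in X - _]xE [RHS]addrC addKr.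
  have ua : \sum_(j | j != a) mpoly_eval u (b j) *: T j = u - c *: T a.
    by have := bx u; rewrite (bigD1 a) //= => /esym uE; rewrite [X in X - _]uE [RHS]addrC addKr.
  rewrite sumrB -scaler_sumr xa ua scalerBr scalerA mulrAC mulVf // mul1r.
  by rewrite opprB [X in _ + X]addrA subrK addrC subrK.
Qed.

End Simplex.

Lemma barycentric_comp m (T : 'I_m -> 'rV[R]_n) b (s : 'I_m -> 'I_m) :
  injective s -> barycentric T b -> barycentric (T \o s) (b \o s).
Proof.
move=> s_inj [b_aff bT b1 bx]; split=> [j|i j|x|x] /=.
- exact: b_aff.
- by rewrite bT (inj_eq s_inj).
- by rewrite -[RHS](b1 x) [RHS](reindex_inj s_inj).
- by rewrite -[RHS](bx x) [RHS](reindex_inj s_inj).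
Qed.

(** The coordinates other than the first are those of x - T 0 in the basis T j - T 0, read
off the inverse of its matrix. *)
Lemma affine_independent_barycentric (T : 'I_n.+1 -> 'rV[R]_n) :
  affine_independent T -> exists b, barycentric T b.
Proof.
rewrite /affine_independent; set M := (X in row_free X).
rewrite row_free_unit => Mu; pose P := invmx M.
pose c (j : 'I_n) : S :=
  \sum_i P i j *: (mvar R i - mpoly.mpolyC n (T ord0 0 i)).
have cE x j : mpoly_eval x (c j) = ((x - T ord0) *m P) 0 j.
  rewrite eval_sum !mxE; apply: eq_bigr => i _.
  by rewrite evalZ evalB evalX evalC !mxE mulrC.
pose b (j : 'I_n.+1) : S :=
  oapp c (mpoly.mpolyC n 1 - \sum_j c j) (unlift ord0 j).
have c_aff j : affine_form (c j).
  apply: affine_form_sum => i; apply/affine_formZ/affine_formB.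
    exact: affine_formX.
  exact: affine_formC.
have bL j : b (lift ord0 j) = c j by rewrite /b liftK.
have b0 : b ord0 = mpoly.mpolyC n 1 - \sum_j c j by rewrite /b unlift_none.
have cT i j : mpoly_eval (T (lift ord0 i)) (c j) = (i == j)%:R.
  rewrite cE (_ : T (lift ord0 i) - T ord0 = row i M); last first.
    by apply/rowP => l; rewrite !mxE.
  by rewrite -row_mul mulmxV // !mxE.
have cT0 j : mpoly_eval (T ord0) (c j) = 0 by rewrite cE subrr mul0mx mxE.
have b1 x : \sum_j mpoly_eval x (b j) = 1.
  rewrite big_ord_recl b0 evalB evalC eval_sum.
  by under [X in _ + X]eq_bigr do rewrite bL; rewrite subrK.
exists b; split => // [j|i j|x].
- case: (unliftP ord0 j) => [j' ->|->]; first by rewrite bL.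
  by rewrite b0; apply/affine_formB/affine_form_sum; first exact: affine_formC.
- case: (unliftP ord0 j) => [j' ->|->].
    rewrite bL; case: (unliftP ord0 i) => [i' ->|->]; last by rewrite cT0.
    by rewrite cT (inj_eq lift_inj).
  rewrite b0 evalB evalC eval_sum.
  case: (unliftP ord0 i) => [i' ->|->]; last first.
    by rewrite eqxx big1 ?subr0 // => j' _; rewrite cT0.
  rewrite (bigD1 i') //= cT eqxx big1 => [|j' ji]; last first.
    by rewrite cT eq_sym (negbTE ji).
  by rewrite addr0 subrr.
- have xT : \sum_j mpoly_eval x (c j) *: (T (lift ord0 j) - T ord0) = x - T ord0.
    rewrite -[RHS]mulmx1 -(mulVmx Mu) mulmxA [RHS]mulmx_sum_row.
    by apply: eq_bigr => j _; rewrite cE rowK.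
  rewrite big_ord_recl b0 evalB evalC eval_sum scalerBl scale1r scaler_suml.
  under [X in _ + X]eq_bigr do rewrite bL.
  rewrite -addrA [X in _ + X](_ : _ = x - T ord0); first by rewrite addrC subrK.
  by rewrite addrC -sumrB -xT; apply: eq_bigr => j _; rewrite scalerBr.
Qed.

(** Join a point x of the hyperplane to the centroid o of the facet opposite to vertex a:
near o this line stays in the facet. *)
Lemma spans_wall_facet m (T : 'I_m.+1 -> 'rV[R]_n) b (a : 'I_m.+1)
    (Y : set 'rV[R]_n) l : (0 < m)%N -> barycentric T b ->
    (forall x, mpoly_eval x (b a) = 0 ->
      (forall j, 0 <= mpoly_eval x (b j)) -> Y x) ->
    (forall x, mpoly_eval x l = 0 -> mpoly_eval x (b a) = 0) ->
  spans_wall Y l.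
Proof.
move=> m0 Tb YP lb p pY x /lb xa; have [b_aff _ _ _] := Tb.
pose c : R := m%:R^-1; have c0 : 0 < c by rewrite invr_gt0 ltr0n.
pose o := \sum_j (if j == a then 0 else c) *: T j.
have oE j : mpoly_eval o (b j) = if j == a then 0 else c.
  rewrite (barycentric_comb Tb) // (bigD1 a) //= eqxx add0r.
  rewrite (eq_bigr (fun=> c)) => [|i /negbTE -> //].
  by rewrite sumr_const cardC1 card_ord -[LHS]mulr_natr mulVf // pnatr_eq0 -lt0n.
have [P [PE _]] := line_polyP p o (x - o).
(* for t below this bound no barycentric coordinate of o + t (x - o) is negative *)
pose e := c / (1 + \sum_j `|mpoly_eval x (b j) - c|).
have s0 : 0 < 1 + \sum_j `|mpoly_eval x (b j) - c|.
  by rewrite ltr_pwDl // sumr_ge0.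
have e0 : 0 < e by rewrite divr_gt0.
have P0 : P = 0.
  apply: (poly_eq0_itv e0) => t /andP[t0 te]; rewrite PE; apply/pY/YP.
    by rewrite (b_aff a).2 oE eqxx xa subrr mulr0 addr0.
  move=> j; rewrite (b_aff j).2 oE; case: eqP => [->|_].
    by rewrite xa subrr mulr0 addr0.
  have tle : t * `|mpoly_eval x (b j) - c| <= c.
    apply: (@le_trans _ _ (t * (1 + \sum_j `|mpoly_eval x (b j) - c|))).
      apply: ler_wpM2l; first exact: ltW.
      rewrite (bigD1 j) //= addrCA lerDl addr_ge0 // sumr_ge0 //.
    by rewrite -ler_pdivlMr // ltW.
  have := ler_norm (- (t * (mpoly_eval x (b j) - c))).
  by rewrite normrN normrM gtr0_norm //; lra.
by have := PE 1; rewrite P0 horner0 scale1r addrC subrK => <-.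
Qed.

End Barycentric.

(** * Alfeld splits and their refinements *)

Section AlfeldGeometry.
Variables (R : realType) (n m : nat) (T : 'I_m.+1 -> 'rV[R]_n).
Variable b : 'I_m.+1 -> poly_ R n.
Hypothesis Tb : barycentric T b.
Implicit Types (x u : 'rV[R]_n).

Lemma eval_alfeld_barycentric u a j x :
  mpoly_eval x (alfeld_barycentric b u a j) =
  if j == a then (mpoly_eval u (b a))^-1 * mpoly_eval x (b a)
  else mpoly_eval x (b j) -
    mpoly_eval u (b j) * ((mpoly_eval u (b a))^-1 * mpoly_eval x (b a)).
Proof.
by rewrite /alfeld_barycentric; case: ifP => _; rewrite ?evalB !evalZ.
Qed.

Lemma barycentric_surj (v : 'I_m.+1 -> R) (t : 'I_m.+1 -> R) :
    \sum_l v l = 1 ->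
  exists x s, forall l, mpoly_eval x (b l) = v l * (t l + s).
Proof.
move=> v1; pose s := 1 - \sum_l v l * t l.
exists (\sum_l (v l * (t l + s)) *: T l), s => l; apply: (barycentric_comb Tb).
under eq_bigr do rewrite mulrDr.
by rewrite big_split /= -mulr_suml v1 mul1r addrC subrK.
Qed.

Variable u : 'rV[R]_n.
Notation v l := (mpoly_eval u (b l)).
Hypothesis v_ge0 : forall l, 0 <= v l.

Lemma hull_alfeld_subset a : 0 < v a -> hull (alfeld T u a) `<=` hull T.
Proof.
move=> va0 x /(hull_barycentric (alfeld_barycentricP Tb (lt0r_neq0 va0))) x0.
apply/(hull_barycentric Tb) => j.
have xa : 0 <= (v a)^-1 * mpoly_eval x (b a).
  by have := x0 a; rewrite eval_alfeld_barycentric eqxx.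
have := x0 j; rewrite eval_alfeld_barycentric; case: eqP => [->|_ H].
  by rewrite pmulr_rge0 // invr_gt0.
by rewrite -(subrK (v j * ((v a)^-1 * mpoly_eval x (b a))) (mpoly_eval x (b j)))
  addr_ge0 // mulr_ge0.
Qed.

(** On this cell the coordinate of index l is b l minus v l times the scaled coordinate of
index a, and is not negative. *)
Lemma hull_alfeld_min a l x : 0 < v a -> 0 < v l -> hull (alfeld T u a) x ->
  (v a)^-1 * mpoly_eval x (b a) <= (v l)^-1 * mpoly_eval x (b l).
Proof.
move=> va0 vl0 /(hull_barycentric (alfeld_barycentricP Tb (lt0r_neq0 va0))) x0.
have := x0 l; rewrite eval_alfeld_barycentric; case: eqP => [-> //|_].
by rewrite subr_ge0 ler_pdivlMl.
Qed.

(** The two cells share the facet of the first one that is opposite to vertex c. *)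
Lemma alfeld_wall a c : (0 < m)%N -> a != c -> 0 < v a -> 0 < v c ->
  spans_wall (hull (alfeld T u a) `&` hull (alfeld T u c))
    ((v a)^-1 *: b a - (v c)^-1 *: b c).
Proof.
move=> m0 ac va0 vc0.
have Ha := alfeld_barycentricP Tb (lt0r_neq0 va0).
have Hc := alfeld_barycentricP Tb (lt0r_neq0 vc0).
apply: (spans_wall_facet (a := c) m0 Ha) => [x|x]; last first.
  rewrite evalB !evalZ eval_alfeld_barycentric eq_sym (negbTE ac) => /eqP.
  by rewrite subr_eq0 => /eqP ->; rewrite mulrA mulfV ?gt_eqF // mul1r subrr.
rewrite eval_alfeld_barycentric eq_sym (negbTE ac) => /eqP.
rewrite subr_eq0 => /eqP xc x0; split; first exact/(hull_barycentric Ha).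
have yc : (v c)^-1 * mpoly_eval x (b c) = (v a)^-1 * mpoly_eval x (b a).
  by rewrite xc mulrA mulVf ?mul1r // gt_eqF.
apply/(hull_barycentric Hc) => j; have xa := x0 a; have xj := x0 j.
move: xa xj; rewrite !eval_alfeld_barycentric eqxx yc => xa.
case: (eqVneq j c) => [//|jc]; case: (eqVneq j a) => [->|//].
by rewrite mulrA mulfV ?mul1r ?subrr // gt_eqF.
Qed.

End AlfeldGeometry.

Section RefinedAlfeldSplit.
Variables (R : realType) (k n : nat) (T : 'I_k.+1 -> 'rV[R]_k).
Variables (b : 'I_k.+1 -> poly_ R k) (u : 'rV[R]_k) (w : 'I_k.+1 -> 'rV[R]_k).
Variables (L : 'I_k.+1 -> 'I_n.+1 -> 'I_k.+1) (rho : 'I_k.+1 -> 'I_k.+1 -> 'I_n.+1).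
Hypotheses (k_gt0 : (0 < k)%N) (Tb : barycentric T b).
Notation mu l := (mpoly_eval u (b l)).
Notation b_ i := (alfeld_barycentric b u i).
Notation om i l := (mpoly_eval (w i) (b_ i l)).
Hypothesis mu_gt0 : forall l, 0 < mu l.
Hypothesis om_ge0 : forall i l, 0 <= om i l.
Hypothesis om_gt0 : forall i a, 0 < om i (L i a).
Hypothesis L_inj : forall i, injective (L i).
Hypothesis L_rho : forall i j, i != j -> L i (rho i j) = j.
(* For w i on the line through T i and u, its coordinates other than the i-th are
   proportional to those of u. *)
Hypothesis om_collinear : exists t : 'I_k.+1 -> R,
  forall i l, l != i -> om i l = mu l * t i.

(** The map L selects the subcells of each outer cell: all of them for the double Alfeld
split, those not opposite to u for the facet split. *)
Definition refined_cell (c : 'I_k.+1 * 'I_n.+1) : 'I_k.+1 -> 'rV[R]_k :=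
  alfeld (alfeld T u c.1) (w c.1) (L c.1 c.2).

Definition outer_coordinate (l : 'I_k.+1) : poly_ R k := (mu l)^-1 *: b l.

Definition inner_coordinate (i : 'I_k.+1) (a : 'I_n.+1) : poly_ R k :=
  (om i (L i a))^-1 *: b_ i (L i a).

Let Tb_ i : barycentric (alfeld T u i) (b_ i).
Proof. exact: (alfeld_barycentricP Tb (lt0r_neq0 (mu_gt0 i))). Qed.

Lemma refined_cell_barycentric c : exists g, barycentric (refined_cell c) g.
Proof.
exists (alfeld_barycentric (b_ c.1) (w c.1) (L c.1 c.2)).
exact: (alfeld_barycentricP (Tb_ c.1) (lt0r_neq0 (om_gt0 c.1 c.2))).
Qed.

Let cell_sub i a x : hull (refined_cell (i, a)) x -> hull (alfeld T u i) x.
Proof. exact: (hull_alfeld_subset (Tb_ i) (om_ge0 i) (om_gt0 i a)). Qed.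

Let outer_min i l x : hull (alfeld T u i) x ->
  mpoly_eval x (outer_coordinate i) <= mpoly_eval x (outer_coordinate l).
Proof. by move=> xi; rewrite !evalZ; exact: (hull_alfeld_min Tb). Qed.

Let inner_min i a c x : hull (refined_cell (i, a)) x ->
  mpoly_eval x (inner_coordinate i a) <= mpoly_eval x (inner_coordinate i c).
Proof. by move=> xi; rewrite !evalZ; exact: (hull_alfeld_min (Tb_ i)). Qed.

Lemma alfeld_braid_coordinates m N (P : 'I_m.+1 -> 'rV[R]_N) g
    (v : 'rV[R]_N) q (J : 'I_q.+1 -> 'I_m.+1) :
    barycentric P g -> injective J -> (forall a, 0 < mpoly_eval v (g (J a))) ->
  braid_coordinates (fun a => (mpoly_eval v (g (J a)))^-1 *: g (J a)).
Proof.
move=> Pg J_inj v0; have [g_aff _ g1 _] := Pg; split=> [a|t].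
  exact: affine_formZ.
pose t' l := oapp t 0 [pick a | J a == l].
have t'E a : t' (J a) = t a.
  rewrite /t'; case: pickP => [a' /eqP /J_inj -> //|/(_ a)].
  by rewrite eqxx.
have [x [s xE]] := barycentric_surj Pg t' (g1 v).
exists x => a c; rewrite !evalZ !xE !t'E !mulrA !mulVf ?gt_eqF // !mul1r.
by rewrite opprD addrACA subrr addr0.
Qed.

Let cancel_scale (oi oj mi mj t D : R) : oi = mi * t -> oj = mj * t ->
  0 < mi -> 0 < mj -> oi^-1 * (mi * D) = oj^-1 * (mj * D).
Proof.
move=> -> -> mi0 mj0.
by rewrite !invfM !mulrA ![_^-1 * _^-1 * _]mulrAC !mulVf ?gt_eqF.
Qed.

(** Ties between different outer cells i and j hold since there the barycentric coordinate
of index j in the outer cell i is zero: this is the least value that any coordinate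
takes.  The tie seen from a third outer cell l rests on collinearity, by which the
forms y l are proportional to the differences with z l.  The wall between the outer
cells i and j is spanned by a single pair of subcells. *)
Lemma refined_split_braid : braid_refinement (fun c => hull (refined_cell c))
  outer_coordinate inner_coordinate rho.
Proof.
have outer_tie i j a c x : hull (refined_cell (i, a)) x ->
    hull (refined_cell (j, c)) x ->
    mpoly_eval x (outer_coordinate i) = mpoly_eval x (outer_coordinate j).
  move=> /cell_sub xi /cell_sub xj.
  by apply/eqP; rewrite eq_le !outer_min.
have bzE i l x : l != i -> mpoly_eval x (b_ i l) =
    mu l * (mpoly_eval x (outer_coordinate l) - mpoly_eval x (outer_coordinate i)).
  move=> li; rewrite eval_alfeld_barycentric (negbTE li) !evalZ mulrBr.
  by congr (_ - _); rewrite mulrA mulfV ?mul1r // gt_eqF.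
have yE i j x : i != j -> mpoly_eval x (inner_coordinate i (rho i j)) =
    (om i j)^-1 * (mu j *
    (mpoly_eval x (outer_coordinate j) - mpoly_eval x (outer_coordinate i))).
  move=> ij; have ji : j != i by rewrite eq_sym.
  by rewrite evalZ L_rho // (bzE _ _ x).
split=> //.
- by apply: (alfeld_braid_coordinates (J := id)) Tb _ _.
- move=> i; exact: (alfeld_braid_coordinates (Tb_ i) (@L_inj i)).
- by move=> i j a c x _; exact: outer_tie.
- move=> i j a c x ij xi xj; have yj0 : mpoly_eval x (inner_coordinate i (rho i j)) = 0.
    by rewrite yE // (outer_tie _ _ _ _ _ xi xj) subrr !mulr0.
  apply/eqP; rewrite eq_le inner_min //= yj0 evalZ.
  apply: mulr_ge0; first by rewrite invr_ge0.
  by have /(hull_barycentric (Tb_ i)) := cell_sub xi; exact.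
- by move=> i a c x xa xc; apply/eqP; rewrite eq_le !inner_min.
- move=> l i j a c x li lj xi xj; rewrite !yE //.
  have [t tE] := om_collinear.
  have := outer_tie _ _ _ _ _ xi xj => ->.
  have [il jl] : i != l /\ j != l by rewrite ![_ == l]eq_sym.
  exact: (cancel_scale _ (tE _ _ il) (tE _ _ jl) (mu_gt0 i) (mu_gt0 j)).
- move=> i a c ac; apply: (alfeld_wall (Tb_ i) k_gt0) => //.
  by apply: contra_neq ac; exact: L_inj.
- move=> i j ij; have ji : j != i by rewrite eq_sym.
  have Li := L_rho ij; have Lj := L_rho ji.
  have oi : 0 < om i j by have := om_gt0 i (rho i j); rewrite Li.
  have oj : 0 < om j i by have := om_gt0 j (rho j i); rewrite Lj.
  rewrite /refined_cell /= Li Lj.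
  have Gi := alfeld_barycentricP (Tb_ i) (lt0r_neq0 oi).
  have Gj := alfeld_barycentricP (Tb_ j) (lt0r_neq0 oj).
  apply: (spans_wall_facet (a := j) k_gt0 Gi) => [x|x]; last first.
    rewrite eval_alfeld_barycentric eqxx (bzE _ _ x) // evalB => /eqP.
    by rewrite subr_eq0 => /eqP ->; rewrite subrr !mulr0.
  move=> xj x0; split; first exact/(hull_barycentric Gi).
  move: xj; rewrite eval_alfeld_barycentric eqxx => /eqP.
  rewrite mulf_eq0 invr_eq0 gt_eqF //= => /eqP xj0.
  have zij : mpoly_eval x (outer_coordinate j) = mpoly_eval x (outer_coordinate i).
    move: xj0; rewrite bzE // => /eqP; rewrite mulf_eq0 gt_eqF //= subr_eq0.
    by move=> /eqP.
  have xb l : l != j -> 0 <= mpoly_eval x (b_ i l).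
    move=> lj; have := x0 l; rewrite eval_alfeld_barycentric (negbTE lj) xj0.
    by rewrite !mulr0 subr0.
  have bji : mpoly_eval x (b_ j i) = 0 by rewrite bzE // zij subrr mulr0.
  apply/(hull_barycentric Gj) => l; rewrite eval_alfeld_barycentric bji !mulr0.
  case: eqP => // /eqP li; rewrite subr0.
  have [->|lj] := eqVneq l j.
    have := xb i ij; rewrite !eval_alfeld_barycentric !eqxx -!evalZ.
    by rewrite -/(outer_coordinate i) -/(outer_coordinate j) zij.
  by have := xb l lj; rewrite !bzE // zij.
Qed.

End RefinedAlfeldSplit.

(** * Passage to the cone *)

Section Homogenization.
Variables (R : realType) (k : nat).
Implicit Types (l : poly_ R k) (x y : 'rV[R]_k) (s : R).

(** The hyperplane at height 1 carries the complex. *)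
Definition cone_point s x : 'rV[R]_(1 + k) := row_mx (const_mx s) x.

Definition homogenize l : poly_ R (1 + k) :=
  mpoly_eval 0 l *: mvar R (lshift k ord0) +
  \sum_i (mpoly_eval (delta_mx 0 i) l - mpoly_eval 0 l) *: mvar R (rshift 1 i).

Lemma homogenize_affine l : affine_form (homogenize l).
Proof.
apply: affine_formD; first exact/affine_formZ/affine_formX.
by apply: affine_form_sum => i; exact/affine_formZ/affine_formX.
Qed.

Lemma eval_homogenize l s x : affine_form l ->
  mpoly_eval (cone_point s x) (homogenize l) =
  s * mpoly_eval 0 l + (mpoly_eval x l - mpoly_eval 0 l).
Proof.
move=> l_aff; rewrite evalD evalZ evalX row_mxEl mxE mulrC; congr (_ + _).
have := affine_form_shift (fun i => x 0 i) (fun i => delta_mx 0 i) 0 0 l_aff.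
under eq_bigr do rewrite subr0.
rewrite -row_sum_delta add0r => ->; rewrite [RHS]addrC addKr eval_sum.
by apply: eq_bigr => i _; rewrite evalZ evalX row_mxEr mulrC.
Qed.

Lemma eval_homogenize_scale l s y : affine_form l ->
  mpoly_eval (cone_point s (s *: y)) (homogenize l) = s * mpoly_eval y l.
Proof.
move=> l_aff; rewrite eval_homogenize //.
have := l_aff.2 0 y 0 s; rewrite subr0 add0r => ->; ring.
Qed.

Lemma cone_point_inj s s' x x' : cone_point s x = cone_point s' x' -> s = s' /\ x = x'.
Proof.
by move=> /eq_row_mx [/(congr1 (fun A : 'rV_1 => A 0 0))]; rewrite !mxE.
Qed.

Lemma cone_pointP (v : 'rV[R]_(1 + k)) : exists s x, v = cone_point s x.
Proof.
exists (lsubmx v 0 0), (rsubmx v); rewrite -[LHS]hsubmxK; congr row_mx.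
by apply/rowP => i; rewrite !mxE ord1.
Qed.

Lemma cone_pointD s s' x x' :
  cone_point s x + cone_point s' x' = cone_point (s + s') (x + x').
Proof. by rewrite add_row_mx; congr row_mx; apply/rowP => i; rewrite !mxE. Qed.

Lemma cone_pointZ t s x : t *: cone_point s x = cone_point (t * s) (t *: x).
Proof. by rewrite scale_row_mx; congr row_mx; apply/rowP => i; rewrite !mxE. Qed.

Lemma cone_point_sum (I : finType) (s : I -> R) (x : I -> 'rV[R]_k) :
  \sum_i cone_point (s i) (x i) = cone_point (\sum_i s i) (\sum_i x i).
Proof.
elim: (index_enum I) => [|i r IH]; last by rewrite !big_cons IH cone_pointD.
by rewrite !big_nil /cone_point -row_mx0; congr row_mx; apply/rowP => i; rewrite !mxE.
Qed.

Variables (I : finType) (D : complex R k I).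

Lemma hat0 c : hat D c ord0 = 0.
Proof. by rewrite /hat /cone_simplex unlift_none. Qed.

Lemma hat_lift c j : hat D c (lift ord0 j) = cone_point 1 (D c j).
Proof. by rewrite /hat /cone_simplex liftK. Qed.

Lemma hull_hat c v : hull (hat D c) v <->
  exists s y, [/\ 0 <= s <= 1, hull (D c) y & v = cone_point s (s *: y)].
Proof.
have pointE (a : 'I_k.+2 -> R) : \sum_j a j *: hat D c j =
    cone_point (\sum_j a (lift ord0 j)) (\sum_j a (lift ord0 j) *: D c j).
  rewrite big_ord_recl hat0 scaler0 add0r -cone_point_sum.
  by apply: eq_bigr => j _; rewrite hat_lift cone_pointZ mulr1.
split=> [[a [a0 a1 ->]]|[s [y [/andP[s0 s1] [a [a0 a1 ->]] ->]]]].
- rewrite pointE; set s := \sum_j _.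
  have s0 : 0 <= s by apply: sumr_ge0.
  have s1 : s <= 1 by rewrite -a1 big_ord_recl lerDr.
  have [sE|s_neq0] := eqVneq s 0.
    exists 0, (D c ord0); split; rewrite ?lexx ?ler01 //.
      exists (fun j => (j == ord0)%:R); split=> [j||].
      - by case: (j == _).
      - by rewrite (bigD1 ord0) //= big1 => [|j /negbTE -> //]; rewrite addr0.
      - rewrite (bigD1 ord0) //= scale1r big1 => [|j /negbTE ->].
          by rewrite addr0.
        by rewrite scale0r.
    rewrite sE scale0r; congr cone_point; apply: big1 => j _.
    have /eqP := sE; rewrite psumr_eq0 // => /allP /(_ j (mem_index_enum _)).
    by move=> /eqP ->; rewrite scale0r.
  exists s, (\sum_j (s^-1 * a (lift ord0 j)) *: D c j); split.
  + by rewrite s0 s1.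
  + exists (fun j => s^-1 * a (lift ord0 j)); split=> //.
      by move=> j; rewrite mulr_ge0 // invr_ge0.
    by rewrite -mulr_sumr mulVf.
  + congr cone_point; rewrite scaler_sumr; apply: eq_bigr => j _.
    by rewrite scalerA mulrA mulfV // mul1r.
- exists (fun j => oapp (fun j' => s * a j') (1 - s) (unlift ord0 j)); split.
  + move=> j; case: unliftP => [j' _|_] /=; first exact: mulr_ge0.
    by rewrite subr_ge0.
  + rewrite big_ord_recl unlift_none /=; under eq_bigr do rewrite liftK /=.
    by rewrite -mulr_sumr a1 mulr1 subrK.
  + rewrite pointE; have sE : \sum_(j < k.+1)
        oapp (fun j' => s * a j') (1 - s) (unlift ord0 (lift ord0 j)) = s.
      by under eq_bigr do rewrite liftK /=; rewrite -mulr_sumr a1 mulr1.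
    rewrite sE; congr cone_point; rewrite scaler_sumr.
    by apply: eq_bigr => j _; rewrite liftK scalerA.
Qed.

Lemma hat_barycentric c g : barycentric (D c) g ->
  barycentric (hat D c) (fun j => oapp (fun j' => homogenize (g j'))
    (mpoly.mpolyC _ 1 - mvar R (lshift k ord0)) (unlift ord0 j)).
Proof.
move=> [g_aff gD g1 gx]; set G := (X in barycentric _ X).
have G0 : G ord0 = mpoly.mpolyC _ 1 - mvar R (lshift k ord0).
  by rewrite /G unlift_none.
have GL j : G (lift ord0 j) = homogenize (g j) by rewrite /G liftK.
have G0E s x : mpoly_eval (cone_point s x) (G ord0) = 1 - s.
  by rewrite G0 evalB evalC evalX row_mxEl mxE.
have GLE s x j : mpoly_eval (cone_point s x) (G (lift ord0 j)) =
    s * mpoly_eval 0 (g j) + (mpoly_eval x (g j) - mpoly_eval 0 (g j)).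
  by rewrite GL eval_homogenize.
have GLsum s x : \sum_j mpoly_eval (cone_point s x) (G (lift ord0 j)) = s.
  rewrite (eq_bigr _ (fun j _ => GLE s x j)) big_split sumrB /= -mulr_sumr !g1.
  by rewrite subrr addr0 mulr1.
have zeroE : (0 : 'rV[R]_(1 + k)) = cone_point 0 0.
  by rewrite /cone_point -row_mx0; congr row_mx; apply/rowP => i; rewrite !mxE.
split.
- move=> j; case: (unliftP ord0 j) => [j' ->|->]; first by rewrite GL; exact: homogenize_affine.
  by rewrite G0; apply: affine_formB; [exact: affine_formC|exact: affine_formX].
- move=> i j; case: (unliftP ord0 i) => [i' ->|->].
    rewrite hat_lift; case: (unliftP ord0 j) => [j' ->|->].
      by rewrite GLE mul1r addrC subrK gD (inj_eq lift_inj).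
    by rewrite G0E subrr.
  rewrite hat0 zeroE; case: (unliftP ord0 j) => [j' ->|->].
    by rewrite GLE mul0r add0r subrr.
  by rewrite G0E subr0 eqxx.
- move=> v; have [s [x ->]] := cone_pointP v.
  by rewrite big_ord_recl G0E GLsum subrK.
- move=> v; have [s [x ->]] := cone_pointP v.
  rewrite big_ord_recl hat0 scaler0 add0r.
  under eq_bigr do rewrite hat_lift cone_pointZ mulr1.
  rewrite cone_point_sum GLsum; congr cone_point.
  under eq_bigr do rewrite GLE scalerDl scalerBl -scalerA.
  by rewrite big_split sumrB /= -scaler_sumr !gx scaler0 add0r subr0.
Qed.

Lemma slice_poly (p : poly_ R (1 + k)) s : exists q : poly_ R k,
  forall y, mpoly_eval y q = mpoly_eval (cone_point s (s *: y)) p.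
Proof.
elim/mpoly_ring_ind: p => [c|i|p1 p2 [q1 E1] [q2 E2]|p1 p2 [q1 E1] [q2 E2]].
- by exists (mpoly.mpolyC k c) => y; rewrite !evalC.
- case: (splitP i) => j ij.
    exists (mpoly.mpolyC k s) => y; rewrite evalC evalX.
    by rewrite (_ : i = lshift k j) ?row_mxEl ?mxE //; exact/val_inj.
  exists (s *: mvar R j) => y; rewrite evalZ !evalX.
  by rewrite (_ : i = rshift 1 j) ?row_mxEr ?mxE //; exact/val_inj.
- by exists (q1 + q2) => y; rewrite !evalD E1 E2.
- by exists (q1 * q2) => y; rewrite !evalM E1 E2.
Qed.

(** On slices at heights in [0, 1] the claim is the one at the base.  Any other point of
the hyperplane is joined to a point at height 1/2, and near the latter the line runs
through such slices. *)
Lemma spans_wall_hat (Y : set 'rV[R]_k) (Z : set 'rV[R]_(1 + k)) l1 l2 :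
    affine_form l1 -> affine_form l2 ->
    (exists y, mpoly_eval y (l1 - l2) = 0) ->
    (forall s y, 0 <= s <= 1 -> Y y -> Z (cone_point s (s *: y))) ->
  spans_wall Y (l1 - l2) -> spans_wall Z (homogenize l1 - homogenize l2).
Proof.
move=> l1_aff l2_aff [y0 y00] YZ Yl p pZ v vl.
have H s y : 0 <= s <= 1 -> mpoly_eval y (l1 - l2) = 0 ->
    mpoly_eval (cone_point s (s *: y)) p = 0.
  move=> s01 yl; have [q qE] := slice_poly p s.
  by rewrite -qE; apply: Yl yl => x xY; rewrite qE; apply: pZ; exact: YZ.
have [sv [xv vE]] := cone_pointP v.
have hl_aff := affine_formB (homogenize_affine l1) (homogenize_affine l2).
pose o := cone_point (1/2) ((1/2) *: y0).
have ol : mpoly_eval o (homogenize l1 - homogenize l2) = 0.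
  by rewrite evalB !eval_homogenize_scale // -mulrBr -evalB y00 mulr0.
have [P [PE _]] := line_polyP p o (v - o).
suff P0 : P = 0 by have := PE 1; rewrite P0 horner0 scale1r addrC subrK => <-.
(* for t below this bound the height of o + t (v - o) is within 1/4 of 1/2 *)
pose e : R := (1/4) / (1 + `|sv - 1/2|).
have e0 : 0 < e by rewrite divr_gt0 // ?ltr_pwDl //; lra.
apply: (poly_eq0_itv e0) => t /andP[t0 te]; rewrite PE.
have lt0 : mpoly_eval (o + t *: (v - o)) (homogenize l1 - homogenize l2) = 0.
  by rewrite hl_aff.2 ol vl subrr mulr0 addr0.
pose s := 1/2 + t * (sv - 1/2).
have [x xE] : exists x, o + t *: (v - o) = cone_point s x.
  have [s' [x xE]] := cone_pointP (o + t *: (v - o)); exists x; rewrite xE.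
  congr cone_point; move: xE; rewrite vE /o -scaleN1r cone_pointZ cone_pointD.
  by rewrite cone_pointZ cone_pointD => /cone_point_inj [<- _]; rewrite /s; ring.
have s01 : 0 < s /\ s < 1.
  have tb : t * `|sv - 1/2| <= 1/4.
    apply: (@le_trans _ _ (t * (1 + `|sv - 1/2|))).
      by apply: ler_wpM2l; [exact: ltW|rewrite lerDr].
    by rewrite -ler_pdivlMr ?ltW // ltr_pwDl.
  have := ler_norm (t * (sv - 1/2)); have := ler_norm (- (t * (sv - 1/2))).
  by rewrite normrN normrM gtr0_norm // /s; lra.
have xE' : cone_point s x = cone_point s (s *: (s^-1 *: x)).
  by rewrite scalerA mulfV ?scale1r // gt_eqF // s01.1.
rewrite xE xE'; apply: H; first by rewrite !ltW ?s01.1 ?s01.2.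
move: lt0; rewrite xE xE' evalB !eval_homogenize_scale // -mulrBr -evalB => /eqP.
by rewrite mulf_eq0 gt_eqF ?s01.1 //= => /eqP.
Qed.

End Homogenization.

Section HatRefinement.
Variables (R : realType) (k n : nat) (D : complex R k ('I_k.+1 * 'I_n.+1)%type).
Variables (z : 'I_k.+1 -> poly_ R k) (y : 'I_k.+1 -> 'I_n.+1 -> poly_ R k).
Variable rho : 'I_k.+1 -> 'I_k.+1 -> 'I_n.+1.

Lemma homogenize_braid m (v : 'I_m.+1 -> poly_ R k) :
  braid_coordinates v -> braid_coordinates (fun a => homogenize (v a)).
Proof.
move=> [v_aff v_surj]; split=> [a|t]; first exact: homogenize_affine.
have [x xE] := v_surj t; exists (cone_point 1 (1 *: x)) => a c.
by rewrite !eval_homogenize_scale // !mul1r.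
Qed.

(** Two cells of the cone meet over the intersection of the cells at the base; at the
apex, where they all meet, homogenized forms vanish. *)
Lemma hat_refinement : braid_refinement (fun c => hull (D c)) z y rho ->
  braid_refinement (fun c => hull (hat D c)) (fun l => homogenize (z l))
    (fun i a => homogenize (y i a)) rho.
Proof.
move=> H; have [z_aff z_surj] := outer_braid H.
have y_aff i := (inner_braid H i).1; have y_surj i := (inner_braid H i).2.
have tie c c' l1 l2 v : affine_form l1 -> affine_form l2 ->
    (forall x, hull (D c) x -> hull (D c') x ->
      mpoly_eval x l1 = mpoly_eval x l2) ->
    hull (hat D c) v -> hull (hat D c') v ->
    mpoly_eval v (homogenize l1) = mpoly_eval v (homogenize l2).
  move=> l1_aff l2_aff E /hull_hat [s [x [_ xc vE]]] /hull_hat [s' [x' [_ xc' vE']]].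
  rewrite vE !eval_homogenize_scale //.
  have [s0|s0] := eqVneq s 0; first by rewrite s0 !mul0r.
  congr (_ * _); apply: E => //; rewrite (_ : x = x') //.
  have := vE; rewrite vE' => /cone_point_inj [ss' /esym].
  by rewrite ss' => /(scalerI s0).
have wall c c' l1 l2 : affine_form l1 -> affine_form l2 ->
    (exists x, mpoly_eval x (l1 - l2) = 0) ->
    spans_wall (hull (D c) `&` hull (D c')) (l1 - l2) ->
    spans_wall (hull (hat D c) `&` hull (hat D c')) (homogenize l1 - homogenize l2).
  move=> l1_aff l2_aff l0; apply: spans_wall_hat => // s x s01 [xc xc'].
  by split; apply/hull_hat; exists s, x.
split.
- exact: homogenize_braid (outer_braid H).
- by move=> i; exact: homogenize_braid (inner_braid H i).
- move=> i j a c v ij vi vj; apply: tie vi vj => // x xi xj.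
  exact: (outer_tie H ij xi xj).
- move=> i j a c v ij vi vj; apply: tie vi vj => // x xi xj.
  exact: (mixed_tie H ij xi xj).
- move=> i a c v va vc; apply: tie va vc => // x xa xc.
  exact: (inner_tie H xa xc).
- move=> l i j a c v li lj vi vj; apply: tie vi vj => // x xi xj.
  exact: (far_tie H li lj xi xj).
- move=> i a c ac; apply: wall => //; last exact: (inner_wall H).
  have [x xE] := y_surj i (fun=> 0); exists x; by rewrite evalB xE subrr.
- move=> i j ij; apply: wall => //; last exact: (outer_wall H).
  have [x xE] := z_surj (fun=> 0); exists x; by rewrite evalB xE subrr.
Qed.

End HatRefinement.

(** * Bases and dimensions *)

Section FiniteBases.
Variables (K : nzRingType) (V : lmodType K) (J : finType) (B : J -> V) (S : set V).

Lemma is_basis_finType :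
    (forall c : J -> K, S (\sum_j c j *: B j)) ->
    (forall c : J -> K, \sum_j c j *: B j = 0 -> forall j, c j = 0) ->
    (forall s, S s -> exists c : J -> K, s = \sum_j c j *: B j) ->
  is_basis S (fun i : 'I_#|J| => B (enum_val i)).
Proof.
move=> BS B0 SB; have sumE (c : J -> K) :
    \sum_(i < #|J|) c (enum_val i) *: B (enum_val i) = \sum_j c j *: B j.
  by rewrite [RHS](reindex _ (onW_bij _ (enum_val_bij J))).
have ffE (c : {ffun 'I_#|J| -> K}) :
    \sum_i c i *: B (enum_val i) = \sum_j c (enum_rank j) *: B j.
  by rewrite -sumE; apply: eq_bigr => i _; rewrite enum_valK.
split=> [c _|c c' _ _|s /SB [c ->]] /=.
- by rewrite ffE; exact: BS.
- rewrite !ffE => /eqP; rewrite -subr_eq0 -sumrB.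
  rewrite (eq_bigr (fun j => (c (enum_rank j) - c' (enum_rank j)) *: B j)); last first.
    by move=> j _; rewrite scalerBl.
  move=> /eqP /B0 cc; apply/ffunP => i; apply/eqP; rewrite -subr_eq0.
  by have := cc (enum_val i); rewrite enum_valK => ->.
- exists [ffun i => c (enum_val i)] => //; rewrite -sumE.
  by apply: eq_bigr => i _; rewrite ffunE.
Qed.

End FiniteBases.

Section MonomialCount.

(** Monomials of degree d in n + 1 variables correspond to sorted lists of length d. *)
Lemma card_bmultinom_deg (n b d : nat) : (d < b)%N ->
  #|[pred m : mpoly.bmultinom n.+1 b | mpoly.mdeg m == d]| = 'C(d + n, n).
Proof.
move=> db; rewrite -(bin_sub (leq_addl d n)) addnK -mpoly.size_basis cardE -(size_map val).
apply/perm_size/uniq_perm.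
- by rewrite map_inj_uniq ?enum_uniq //; exact: val_inj.
- exact: mpoly.uniq_basis.
move=> m; rewrite -mpoly.basis_cover; apply/mapP/idP => [[m' m'd ->]|md].
  by move: m'd; rewrite mem_enum.
have mb : (mpoly.mdeg m < b)%N by rewrite (eqP md).
by exists (mpoly.BMultinom mb); rewrite ?mem_enum.
Qed.

Lemma card_bmultinom (k d e : nat) : (0 < k)%N ->
  #|{: mpoly.bmultinom k (d.+1 - e)}| = binz ((d + k)%N%:Z - e%:Z) k.
Proof.
case: k => // n _.
have cardE b : #|{: mpoly.bmultinom n.+1 b}| = 'C(b + n, n.+1).
  rewrite -sum1_card.
  rewrite (partition_big (fun m : mpoly.bmultinom n.+1 b => inord (mpoly.mdeg m) : 'I_b.+1)
    (fun d : 'I_b.+1 => d < b)%N) /=; last first.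
    by move=> m _; rewrite inordK ?mpoly.bmdeg // ltnW // ltnS mpoly.bmdeg.
  rewrite (eq_bigr (fun d : 'I_b.+1 => 'C(d + n, n))) => [|i ib]; last first.
    rewrite -(card_bmultinom_deg n ib) sum1_card; apply: eq_card => m.
    have mb : (mpoly.mdeg m < b.+1)%N by rewrite ltnW // ltnS mpoly.bmdeg.
    rewrite !unfold_in /=; apply/eqP/eqP => [<-|mi]; first by rewrite inordK.
    by rewrite mi inord_val.
  rewrite (big_ord_narrow (leqnSn b)) /=.
  elim: b => [|b IH]; first by rewrite big_ord0 bin_small.
  by rewrite big_ord_recr /= IH addSn binS addnC.
rewrite cardE /binz; case: (leqP e d) => ed.
  have -> : (d + n.+1)%N%:Z - e%:Z = (d - e + n.+1)%N%:Z by lia.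
  by congr 'C(_, _); lia.
have -> : (d.+1 - e = 0)%N by lia.
rewrite bin_small //; case: (leqP e (d + n.+1)) => edn.
  have -> : (d + n.+1)%N%:Z - e%:Z = (d + n.+1 - e)%N%:Z by lia.
  by rewrite bin_small //; lia.
have -> : (d + n.+1)%N%:Z - e%:Z = Negz (e - (d + n.+1)).-1 by lia.
by [].
Qed.

Lemma braid_exponent_sum (k n d r : nat) :
  (\sum_(j < n) binz ((d + k)%N%:Z - (braid_exponent n r j)%:Z) k =
   if odd r then n * binz ((d + k)%N%:Z - ((r.+1 * n.+1) %/ 2)%N%:Z) k
   else \sum_(j < n) binz ((d + k)%N%:Z - 1 - j%:Z - ((r * n.+1) %/ 2)%N%:Z) k)%N.
Proof.
have rE : r = (odd r + r./2.*2)%N by rewrite odd_double_half.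
rewrite /braid_exponent; case: (odd r) rE => rE.
  rewrite sum_nat_const card_ord; congr (_ * binz (_ - Posz _) _)%N.
  have -> : (r.+1 * n.+1 = (r./2 * n.+1 + n.+1) * 2)%N by rewrite {1}rE; lia.
  by rewrite mulnK.
apply: eq_bigr => j _; congr binz.
have -> : (r * n.+1 = (r./2 * n.+1) * 2)%N by rewrite {1}rE; lia.
rewrite mulnK //; lia.
Qed.

End MonomialCount.

Section SplineModules.
Variables (R : realType) (N k n r : nat).
Variable D : complex R N ('I_k.+1 * 'I_n.+1)%type.
Variables (z : 'I_k.+1 -> poly_ R N) (y : 'I_k.+1 -> 'I_n.+1 -> poly_ R N).
Variable rho : 'I_k.+1 -> 'I_k.+1 -> 'I_n.+1.
Hypothesis D_bary : forall c, exists g, barycentric (D c) g.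
Hypothesis D_refines : braid_refinement (fun c => hull (D c)) z y rho.
Notation A := (realization D).
Notation J := (spline_label k n).
Notation B := (spline_basis z y rho r).

Let D_closed c : closed (hull (D c)).
Proof. by have [g Dg] := D_bary c; exact: closed_hull Dg. Qed.

Let D_regular c : hull (D c) `<=` closure (hull (D c))°.
Proof. by have [g Dg] := D_bary c; exact: (regular_hull Dg). Qed.

Let subA c x : hull (D c) x -> A x.
Proof. by move=> xc; exists c. Qed.

Lemma eval_eq0_hull c (p : poly_ R N) :
  (forall x, hull (D c) x -> mpoly_eval x p = 0) -> p = 0.
Proof.
have [g Dg] := D_bary c; have v : hull (D c) (D c ord0).
  by apply/(hull_barycentric Dg) => j; have [_ -> _ _] := Dg; case: eqP.
have [x [xc _]] := D_regular v filterT.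
exact: eval_eq0_interior xc.
Qed.

Let basis_function :
  {F : J -> 'rV[R]_N -> R | forall j, pieces D (F j) (B j)}.
Proof.
apply: cid; have /fin_all_exists [f fB] : forall j, exists f, pieces D f (B j).
  by move=> j; exact: glue_pieces (spline_basis_compatible D_refines r j).
by exists f.
Qed.

Let F := sval basis_function.
Let FE : forall j, pieces D (F j) (B j) := svalP basis_function.

Let comb (C : J -> poly_ R N) (x : 'rV[R]_N) : R :=
  \sum_j mpoly_eval x (C j) * F j x.

Let comb_pieces C : pieces D (comb C) (fun c => \sum_j C j * B j c).
Proof.
move=> c x xc; rewrite eval_sum; apply: eq_bigr => j _.
by rewrite evalM (FE j xc).
Qed.

Let comb_Cr C : Cr A r (comb C).
Proof.
apply: (compatible_Cr D_closed (comb_pieces C)).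
exact: compatible_sum (spline_basis_compatible D_refines r).
Qed.

Let comb_eq0 C : (forall x, A x -> comb C x = 0) -> forall j, C j = 0.
Proof.
move=> C0; apply: (spline_basis_free D_refines (r := r)) => c.
by apply: (@eval_eq0_hull c) => x xc; rewrite -(comb_pieces C xc) C0 //; exact: subA xc.
Qed.

Let comb_span f (p : _ -> poly_ R N) : Cr A r f -> pieces D f p ->
  exists2 C, forall x, A x -> f x = comb C x &
    forall d, (forall c, (mpoly.msize (p c) <= d.+1)%N) ->
      forall j, (mpoly.msize (C j) <= d.+1 - @spline_degree k n r j)%N.
Proof.
move=> fC fp; have pX := Cr_compatible D_regular fp fC.
have [C CE Cd] := spline_basis_span D_refines pX.
exists C => // x [c _ xc]; by rewrite (fp c x xc) CE (comb_pieces C xc).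
Qed.

Lemma spline_module_free : spline_free D r.
Proof.
exists #|J|; pose b j : polyfun A := sigL A (F j).
have bE (C : J -> poly_ R N) : \sum_j C j *: b j = sigL A (comb C) :> polyfun A.
  by apply/funext => x; rewrite fct_sumE.
exists (fun i => b (enum_val i)); apply: (@is_basis_finType _ _ J b).
- move=> C; exists (comb C); last by rewrite bE.
  split; first exact: comb_Cr.
  by move=> c; exists (\sum_j C j * B j c); exact: comb_pieces.
- move=> C; rewrite bE => C0; apply: comb_eq0 => x Ax.
  have := congr1 (fun g : polyfun A => g (exist _ x (mem_set Ax))) C0.
  by [].
- move=> _ [f [fC /fin_all_exists [p fp]] <-].
  have [C fE _] := comb_span fC fp; exists C; rewrite bE.
  by apply/funext => -[x xA]; apply: fE; exact: set_mem.
Qed.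

(** By the degree bounds in [spline_basis_span], a spline of degree d has coefficients of
degree at most d minus the degree of the basis element; monomials of these degrees
times the basis elements form a basis over R. *)
Lemma spline_le_dim d : has_dim (spline_le D r d)
  (\sum_(j : J) #|{: mpoly.bmultinom N (d.+1 - @spline_degree k n r j)}|)%N.
Proof.
pose M (j : J) : finType := mpoly.bmultinom N (d.+1 - @spline_degree k n r j).
pose K : finType := {j : J & M j}.
have -> : (\sum_(j : J) #|{: mpoly.bmultinom N (d.+1 - @spline_degree k n r j)}|)%N
    = #|K|.
  rewrite card_tagged sumnE big_map big_enum //.
pose mon (h : K) : poly_ R N := mpoly.mpolyX R (tagged h : mpoly.bmultinom N _).
pose C (c : K -> R) (j : J) : poly_ R N :=
  \sum_(m : M j) c (Tagged M m) *: mpoly.mpolyX R (m : mpoly.bmultinom N _).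
pose b (h : K) : A -> R^o := sigL A (fun x => mpoly_eval x (mon h) * F (tag h) x).
have bE (c : K -> R) : \sum_h c h *: b h = sigL A (comb (C c)) :> (A -> R^o).
  apply/funext => x; rewrite fct_sumE.
  transitivity (\sum_j \sum_(m : M j) c (Tagged M m) *
      (mpoly_eval (\val x) (mon (Tagged M m)) * F j (\val x))).
    by rewrite sig_big_dep; apply: eq_bigr => -[j m] _.
  apply: eq_bigr => j _; rewrite eval_sum mulr_suml.
  by apply: eq_bigr => m _; rewrite evalZ mulrA.
have Cdeg c j : (mpoly.msize (C c j) <= d.+1 - @spline_degree k n r j)%N.
  apply: msize_sum_leq => m _; apply: msizeZ_leq.
  by rewrite mpoly.msizeX; exact: mpoly.bmdeg.
exists (fun i => b (enum_val i)); apply: (@is_basis_finType _ _ K b).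
- move=> c; exists (comb (C c)); last by rewrite bE.
  split; first exact: comb_Cr.
  move=> c'; exists (\sum_j C c j * B j c'); split; last exact: comb_pieces.
  apply: msize_sum_leq => j _; apply: (msizeM_filtered (Cdeg c j)).
  exact: (msize_spline_basis D_refines r j c').
- move=> c; rewrite bE => c0.
  have C0 : forall j, C c j = 0.
    apply: comb_eq0 => x Ax.
    exact: (congr1 (fun g : A -> R^o => g (exist _ x (mem_set Ax))) c0).
  move=> [j m]; have := congr1 (mpoly.mcoeff (m : mpoly.bmultinom N _)) (C0 j).
  rewrite raddf_sum mpoly.mcoeff0 (bigD1 m) //= mpoly.mcoeffZ mpoly.mcoeffX eqxx mulr1.
  rewrite big1 ?addr0 // => m' m'm.
  by rewrite mpoly.mcoeffZ mpoly.mcoeffX (inj_eq val_inj) (negbTE m'm) mulr0.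
- move=> _ [f [fC fp] <-].
  have /fin_all_exists [p pP] := fp.
  have [C' fE C'd] := comb_span fC (fun c => (pP c).2).
  exists (fun h => mpoly.mcoeff (tagged h : mpoly.bmultinom N _) (C' (tag h))).
  rewrite bE; apply/funext => -[x xA]; rewrite /sigL /= fE; last exact: set_mem.
  apply: eq_bigr => j _; congr (mpoly_eval _ _ * _).
  by rewrite [LHS](mpoly.mpolywE (C'd d (fun c => (pP c).1) j)).
Qed.

End SplineModules.

(** * The facet split and the double Alfeld split *)

Section RefinedSplitSplines.
Variables (R : realType) (k n : nat) (T : simplex R k k.+1).
Variables (b : 'I_k.+1 -> poly_ R k) (u : 'rV[R]_k) (w : 'I_k.+1 -> 'rV[R]_k).
Variables (L : 'I_k.+1 -> 'I_n.+1 -> 'I_k.+1) (rho : 'I_k.+1 -> 'I_k.+1 -> 'I_n.+1).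
Variable D : complex R k ('I_k.+1 * 'I_n.+1)%type.
Variable s : 'I_k.+1 * 'I_n.+1 -> 'I_k.+1 -> 'I_k.+1.
Hypotheses (k_gt0 : (0 < k)%N) (Tb : barycentric T b) (Tu : relint T u).
Hypothesis w_line : forall i, line (T i) u (w i).
Hypothesis w_ge0 : forall i l, 0 <= mpoly_eval (w i) (alfeld_barycentric b u i l).
Hypothesis w_gt0 : forall i a, 0 < mpoly_eval (w i) (alfeld_barycentric b u i (L i a)).
Hypothesis L_inj : forall i, injective (L i).
Hypothesis L_rho : forall i j, i != j -> L i (rho i j) = j.
Hypothesis s_inj : forall c, injective (s c).
Hypothesis D_cell : forall c, D c = refined_cell T u w L c \o s c.

Let mu_gt0 l : 0 < mpoly_eval u (b l).
Proof. exact: (relint_barycentric Tb Tu). Qed.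

Lemma line_collinear : exists t : 'I_k.+1 -> R, forall i l, l != i ->
  mpoly_eval (w i) (alfeld_barycentric b u i l) = mpoly_eval u (b l) * t i.
Proof.
have [b_aff bT _ _] := Tb.
have /fin_all_exists [t tE] : forall i, exists t,
    w i = (1 - t) *: T i + t *: u := w_line.
(* from the coordinates of w i = (1 - t) T i + t u once vertex i is replaced by u *)
exists (fun i => t i - (mpoly_eval u (b i))^-1 * (1 - t i + t i * mpoly_eval u (b i))).
have wE i l : mpoly_eval (w i) (b l) =
    (1 - t i) * (i == l)%:R + t i * mpoly_eval u (b l).
  have -> : w i = T i + t i *: (u - T i).
    by rewrite tE scalerBl scale1r scalerBr addrA addrAC.
  rewrite (b_aff l).2 bT; ring.
move=> i l li; rewrite eval_alfeld_barycentric (negbTE li) !wE eqxx eq_sym (negbTE li).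
by rewrite mulr0 add0r mulr1 mulrBr [t i * _]mulrC.
Qed.

Let refines : braid_refinement (fun c => hull (D c))
  (outer_coordinate b u) (inner_coordinate b u w L) rho.
Proof.
have H := refined_split_braid k_gt0 Tb mu_gt0 w_ge0 w_gt0 L_inj L_rho line_collinear.
suff -> : (fun c => hull (D c)) = (fun c => hull (refined_cell T u w L c)) by [].
apply/funext => c.
have [g Cg] := refined_cell_barycentric Tb mu_gt0 w_gt0 c.
have Dg : barycentric (D c) (g \o s c).
  by rewrite D_cell; exact: barycentric_comp (s_inj (c := c)) Cg.
apply/seteqP; split=> x.
  move/(hull_barycentric Dg) => x0; apply/(hull_barycentric Cg) => j.
  by have := x0 (invF (s_inj (c := c)) j); rewrite /= f_invF.
by move/(hull_barycentric Cg) => x0; apply/(hull_barycentric Dg) => j; exact: x0.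
Qed.

Let D_bary c : exists g, barycentric (D c) g.
Proof.
have [g Cg] := refined_cell_barycentric Tb mu_gt0 w_gt0 c.
by exists (g \o s c); rewrite D_cell; exact: barycentric_comp (s_inj (c := c)) Cg.
Qed.

Lemma refined_split_free r : spline_free (hat D) r.
Proof.
apply: (@spline_module_free R (1 + k) k n r (hat D) _ _ _ _ (hat_refinement refines)).
by move=> c; have [g Dg] := D_bary c; eexists; exact: hat_barycentric Dg.
Qed.

Lemma refined_split_dim r d : has_dim (spline_le D r d)
  ('C(d + k, k) + \sum_(j < k) binz ((d + k)%N%:Z - (braid_exponent k r j)%:Z) k
   + k.+1 * \sum_(j < n) binz ((d + k)%N%:Z - (braid_exponent n r j)%:Z) k)%N.
Proof.
have := @spline_le_dim R k k n r D _ _ _ D_bary refines d.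
congr has_dim; rewrite big_sumType /= big_ord_recl; congr (_ + _ + _)%N.
- rewrite card_bmultinom // /braid_degree unlift_none.
  by rewrite -[RHS]/(binz (d + k)%N%:Z k); congr binz; exact: subr0.
- by apply: eq_bigr => j _; rewrite card_bmultinom // /braid_degree liftK.
- rewrite (eq_bigr (fun h : 'I_k.+1 * 'I_n =>
    binz ((d + k)%N%:Z - (braid_exponent n r h.2)%:Z) k)); last first.
    by move=> [i j] _; rewrite card_bmultinom.
  rewrite -(pair_bigA _ (fun (i : 'I_k.+1) (j : 'I_n) =>
    binz ((d + k)%N%:Z - (braid_exponent n r j)%:Z) k)) /=.
  by rewrite sum_nat_const card_ord.
Qed.

End RefinedSplitSplines.

Section FacetCells.
Variables (R : realType) (k : nat) (T : simplex R k.+1 k.+2).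

Definition facet_cell_vertex (c : 'I_k.+2 * 'I_k.+1) (j : 'I_k.+2) : 'I_k.+2 :=
  oapp (lift c.1) c.1 (unlift ord0 j).

Lemma facet_cell_vertex_inj c : injective (facet_cell_vertex c).
Proof.
move=> j j'; rewrite /facet_cell_vertex.
case: unliftP => [i ->|->]; case: unliftP => [i' ->|->] //=.
- by move=> /lift_inj ->.
- by move=> /eqP; rewrite eq_sym (negbTE (neq_lift _ _)).
- by move=> /eqP; rewrite (negbTE (neq_lift _ _)).
Qed.

(** A cell of the facet split is a refined cell with its vertices in another order: u
comes first instead of replacing vertex i. *)
Lemma facet_splitE u w c :
  facet_split T u w c = refined_cell T u w (fun i => lift i) c \o facet_cell_vertex c.
Proof.
case: c => i a; apply/funext => j.
rewrite /facet_split /cone_simplex /refined_cell /facet_cell_vertex /alfeld /facet /=.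
case: unliftP => [j' _|_] /=; last by rewrite (negbTE (neq_lift _ _)) eqxx.
by rewrite (inj_eq lift_inj) [lift i j' == i]eq_sym (negbTE (neq_lift _ _)).
Qed.

Lemma relint_facet b u i w : barycentric T b -> relint T u -> relint (facet T i) w ->
  (forall a, 0 < mpoly_eval w (alfeld_barycentric b u i (lift i a))) /\
  forall l, 0 <= mpoly_eval w (alfeld_barycentric b u i l).
Proof.
move=> Tb Tu [a [a0 a1 wE]]; have [b_aff bT _ _] := Tb.
have wi : mpoly_eval w (b i) = 0.
  rewrite wE affine_form_comb // big1 // => j _.
  by rewrite bT eq_sym (negbTE (neq_lift _ _)) mulr0.
have wl j : 0 < mpoly_eval w (alfeld_barycentric b u i (lift i j)).
  rewrite eval_alfeld_barycentric eq_sym (negbTE (neq_lift _ _)) wi !mulr0 subr0.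
  rewrite wE affine_form_comb // (bigD1 j) //= bT eqxx mulr1 big1 ?addr0 // => j' j'j.
  by rewrite bT (inj_eq lift_inj) (negbTE j'j) mulr0.
split=> // l; case: (unliftP i l) => [j ->|->]; first exact/ltW/wl.
by rewrite eval_alfeld_barycentric eqxx wi mulr0.
Qed.

End FacetCells.

Theorem theorem3p5 (R : realType) (k : nat) (T : simplex R k k.+1)
  (k_gt0 : (0 < k)%N) (T_indep : affine_independent T) :
  (forall (u : 'rV[R]_k) (w : 'I_k.+1 -> 'rV[R]_k),
     (1 < k)%N -> facet_split_points T u w ->
     (forall r d : nat,
        has_dim (spline_le (facet_split T u w) r d)
          ('C(d + k, k) + Adim k d r + k.+1 * Pdim k d r)%N) /\
     (forall r : nat, spline_free (hat (facet_split T u w)) r))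
  /\
  (forall (u : 'rV[R]_k) (w : 'I_k.+1 -> 'rV[R]_k),
     double_alfeld_points T u w ->
     (forall r d : nat,
        has_dim (spline_le (double_alfeld T u w) r d)
          ('C(d + k, k) + k.+2 * Adim k d r)%N) /\
     (forall r : nat, spline_free (hat (double_alfeld T u w)) r)).
Proof.
have [b Tb] := affine_independent_barycentric T_indep; split=> u w.
- case: k T k_gt0 T_indep b Tb u w => // k T' _ _ b Tb u w k_gt1 [Tu Tw].
  have wP i := relint_facet Tb Tu (Tw i).1.
  have w_line i := (Tw i).2.
  have w_gt0 i := (wP i).1.
  have w_ge0 i := (wP i).2.
  pose rho (i j : 'I_k.+2) : 'I_k.+1 := odflt ord0 (unlift i j).
  have L_rho i j : i != j -> lift i (rho i j) = j.
    by rewrite /rho => ij; case: unliftP => [j' ->//|ji]; rewrite ji eqxx in ij.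
  have L_inj (i : 'I_k.+2) : injective (lift i) by exact: lift_inj.
  have cell := facet_splitE T' u w.
  have s_inj := @facet_cell_vertex_inj k.
  split=> [r d|r]; last first.
    exact: (refined_split_free (ltnW k_gt1) Tb Tu w_line w_ge0 w_gt0 L_inj L_rho s_inj cell).
  have := refined_split_dim (ltnW k_gt1) Tb Tu w_line w_ge0 w_gt0 L_inj L_rho s_inj cell r d.
  by rewrite !braid_exponent_sum /Adim /Pdim subn1.
- move=> [Tu Tw]; have Tb_ i : barycentric (alfeld T u i) (alfeld_barycentric b u i).
    exact: (alfeld_barycentricP Tb (lt0r_neq0 (relint_barycentric Tb Tu i))).
  have w_gt0 i a := relint_barycentric (Tb_ i) (Tw i).1 a.
  have w_ge0 i a := ltW (w_gt0 i a).
  have w_line i := (Tw i).2.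
  have L_inj (i : 'I_k.+1) : injective (@id 'I_k.+1) by [].
  have L_rho (i j : 'I_k.+1) : i != j -> id j = j by [].
  have cell c : double_alfeld T u w c = refined_cell T u w (fun=> id) c \o id by [].
  have s_inj (c : 'I_k.+1 * 'I_k.+1) : injective (@id 'I_k.+1) by [].
  split=> [r d|r]; last first.
    exact: (refined_split_free k_gt0 Tb Tu w_line w_ge0 w_gt0 L_inj L_rho s_inj cell).
  have := refined_split_dim k_gt0 Tb Tu w_line w_ge0 w_gt0 L_inj L_rho s_inj cell r d.
  by rewrite !braid_exponent_sum -/(Adim k d r) -addnA -mulSn.
Qed.
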